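(* Let $\nu>-1$. If $f\in\mathcal{S}^+(\mathbb{R}^+)$, then $\mathcal{F}_\nu f\in\mathcal{S}^+(\mathbb{R}^+)$. Moreover $\mathcal{F}_\nu^2=I$ on $\mathcal{S}^+(\mathbb{R}^+)$, i.e. $\mathcal{F}_\nu(\mathcal{F}_\nu f)=f$ for all $f\in\mathcal{S}^+(\mathbb{R}^+)$.
   Context: $\mathbb{R}^+=(0,\infty)$. $J_\nu(x)=\sum_{n=0}^\infty \frac{(-1)^n}{n!\,\Gamma(n+\nu+1)}\left(\frac{x}{2}\right)^{2n+\nu}$ is the Bessel function of the first kind and $\varphi_\nu(x)=x^{-\nu}J_\nu(x)$. The Fourier--Bessel transform of order $\nu$ is $\mathcal{F}_\nu f(y)=\int_{\mathbb{R}^+}\varphi_\nu(xy)f(x)x^{2\nu+1}\,dx$ for $y\in\mathbb{R}^+$. The half-line Schwartz space is $\mathcal{S}^+(\mathbb{R}^+)=\{f|_{\mathbb{R}^+} : f\in\mathcal{S}(\mathbb{R}),\ f(-x)=f(x)\}$, where $\mathcal{S}(\mathbb{R})$ is the usual Schwartz space on $\mathbb{R}$. *)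

(* Defs.v *)
From HB Require Import structures.
From mathcomp Require Import all_boot all_order all_algebra.
From mathcomp Require Import all_classical all_reals all_analysis.
From mathcomp Require Import complex.

Set Implicit Arguments.
Unset Strict Implicit.
Unset Printing Implicit Defensive.

Import Order.TTheory GRing.Theory Num.Theory.
Import numFieldNormedType.Exports.

Local Open Scope classical_set_scope.
Local Open Scope ring_scope.
Local Open Scope complex_scope.

Section FourierBessel.
Context {R : realType}.
Local Notation mu := (@lebesgue_measure R).
Implicit Types (nu s x y : R) (f g : R -> R[i]).

(* Euler's integral: meaningful for [0 < s] only, which covers every value
   [n + nu + 1] with [-1 < nu] used below. *)
Definition Gamma s : R :=
  \int[mu]_(t in `]0, +oo[) (t `^ (s - 1) * expR (- t)).

(* The real powers [a `^ p] below are meant for [0 < a] only. *)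
Definition besselJ nu x : R :=
  limn (series (fun n : nat =>
    (-1) ^+ n / (n`!%:R * Gamma (n%:R + nu + 1))
      * (x / 2) `^ (2 * n%:R + nu))).

Definition bessel_phi nu x : R := x `^ (- nu) * besselJ nu x.

(* [R[i]] is not equipped with a normed [R]-module structure, so integration
   and differentiation of complex-valued functions of a real variable are
   done on the real and imaginary parts. *)
Definition Cintegrable (D : set R) f : Prop :=
  mu.-integrable D (fun x => (complex.Re (f x))%:E) /\
  mu.-integrable D (fun x => (complex.Im (f x))%:E).

Definition Cintegral (D : set R) f : R[i] :=
  (\int[mu]_(x in D) complex.Re (f x)) +i* (\int[mu]_(x in D) complex.Im (f x)).

Definition Cderive1n (n : nat) f x : R[i] :=
  derive1n n (fun t => complex.Re (f t)) x +i* derive1n n (fun t => complex.Im (f t)) x.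

Definition Csmooth f : Prop :=
  forall (n : nat) x,
    derivable (derive1n n (fun t => complex.Re (f t))) x 1 /\
    derivable (derive1n n (fun t => complex.Im (f t))) x 1.

Definition schwartz f : Prop :=
  Csmooth f /\
  forall k n : nat, exists C : R, forall x,
    `|x| ^+ k * Normc.normc (Cderive1n n f x) <= C.

(* A function on the half-line (0, oo) is represented by a function on [R]
   whose values outside (0, oo) are irrelevant. *)
Definition schwartz_half f : Prop :=
  exists g, [/\ schwartz g, forall x, g (- x) = g x
              & forall x, 0 < x -> f x = g x].

Definition fourier_bessel_integrand nu f y x : R[i] :=
  (bessel_phi nu (x * y))%:C * f x * (x `^ (2 * nu + 1))%:C.

Definition fourier_bessel nu f y : R[i] :=
  Cintegral `]0, +oo[ (fourier_bessel_integrand nu f y).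

End FourierBessel.

(* Main.v *)
(* Let [D f = - f' / x] and let [F_nu] be the transform.  The recurrences
   [phi_nu' = - x phi_(nu+1)] and [phi_nu = (2 nu + 2) phi_(nu+1) - x^2 phi_(nu+2)]
   give [F_nu f = F_(nu+1) (D f)] and [F_nu (x f' + (2 nu + 2) f) = y^2 F_(nu+1) f]
   by parts, and [D (F_nu f) = F_(nu+1) f] under the integral sign.  Since [D]
   preserves even Schwartz functions (Hadamard's lemma), [F_nu] does too: its
   derivatives are polynomial combinations of the [F_mu f], and [y^2 F_nu f] is
   again a transform, so only boundedness is needed.
   For the inversion, [T = F_nu^2] commutes with multiplication by [x^2].  If
   [f x0 = 0] then [f = (x^2 - x0^2) h] with [h] even and Schwartz, so
   [T f x0 = 0]; hence [T] is multiplication by a function, and this function is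
   [1] because [exp (- x^2 / 2)] is fixed by [F_nu]. *)
Require Import Defs.
From mathcomp Require Import all_boot all_order all_algebra.
From mathcomp Require Import all_classical all_reals all_analysis.
From mathcomp Require Import measurable_realfun.
From mathcomp Require Import complex.
From mathcomp Require Import ring lra.

Set Implicit Arguments.
Unset Strict Implicit.
Unset Printing Implicit Defensive.

Import Order.TTheory GRing.Theory Num.Theory.
Import numFieldNormedType.Exports.

Local Open Scope classical_set_scope.
Local Open Scope ring_scope.

(** * Real Schwartz functions *)

Section RealSchwartz.
Context {R : realType}.
Implicit Types (f g q u h : R -> R) (Q : (R -> R) -> Prop).

(** The range [-1 < nu] shapes the estimates. For nu < -1/2 the kernel [Phi nu] is unbounded, so the
    transform cannot be bounded by putting absolute values under the integral. A decreasing energy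
    bounds the kernel from order -1/2 on, and every order nu + 1 is positive; uniform estimates are
    therefore made after one shift of the order, and no asymptotics of Bessel functions enter. Read
    as a power series in x^2, the kernel lives on the whole line and is even, so the transform is
    from the outset an even function on R, ready to witness membership in the half-line Schwartz
    space. The operator D appears through a function [h] with f' = x h, that is, D f = - h; this
    accounts for the signs. The kernel being real, complex functions are handled through their real
    and imaginary parts. *)

Definition rapid f := forall k : nat, exists C, forall x, `|x| ^+ k * `|f x| <= C.

Definition rschwartz f :=
  (forall n x, derivable (derive1n n f) x 1) /\ forall n, rapid (derive1n n f).

(** The module generated by [Q] over the polynomials. Rapid decay passes from the generators to all
    of it. *)
Inductive polyspan Q : (R -> R) -> Prop :=
| polyspan_base q : Q q -> polyspan Q q
| polyspan_add f g : polyspan Q f -> polyspan Q g ->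
    polyspan Q (fun x => f x + g x)
| polyspan_scale c f : polyspan Q f -> polyspan Q (fun x => c * f x)
| polyspan_mulx f : polyspan Q f -> polyspan Q (fun x => x * f x).

Lemma is_derive_add f g (x df dg : R) : is_derive x 1 f df -> is_derive x 1 g dg ->
  is_derive x 1 (fun x => f x + g x) (df + dg).
Proof. exact: is_deriveD. Qed.

Lemma is_derive_mul f g (x df dg : R) : is_derive x 1 f df -> is_derive x 1 g dg ->
  is_derive x 1 (fun x => f x * g x) (df * g x + f x * dg).
Proof.
move=> Df Dg; apply: (is_derive_eq (is_deriveM Df Dg)).
by rewrite /GRing.scale /= addrC mulrC.
Qed.

Lemma is_derive_scale f (c x df : R) : is_derive x 1 f df ->
  is_derive x 1 (fun x => c * f x) (c * df).
Proof. exact: is_deriveZ. Qed.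

Lemma is_derive_ext f g (x df dg : R) : is_derive x 1 f df -> f =1 g -> df = dg ->
  is_derive x 1 g dg.
Proof. by move=> Df /funext <- <-. Qed.

Lemma is_derive_funE f (df : R -> R) : (forall x : R, is_derive x 1 f (df x)) -> (derive1 f) = df.
Proof. by move=> Df; apply/funext => x; rewrite derive1E derive_val. Qed.

Lemma rapid_polyspan Q : (forall q, Q q -> rapid q) -> forall f, polyspan Q f -> rapid f.
Proof.
move=> rQ f; elim=> {f} [q /rQ//|f g _ rf _ rg|c f _ rf|f _ rf] k.
- have [C1 H1] := rf k; have [C2 H2] := rg k; exists (C1 + C2) => x.
  by rewrite (le_trans _ (lerD (H1 x) (H2 x)))// -mulrDr ler_wpM2l// ler_normD.
- have [C H] := rf k; exists (`|c| * C) => x.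
  by rewrite normrM mulrCA ler_wpM2l.
- have [C H] := rf k.+1; exists C => x.
  by rewrite normrM mulrA -exprSr.
Qed.

(** By the product rule the span is closed under differentiation as soon as the generators have
    their derivatives in it. All derivatives of [f] then stay in the span, so only the decay of the
    generators has to be checked. Every Schwartz function below is obtained in this way. *)
Lemma polyspan_schwartz Q :
  (forall q, Q q -> exists2 d, polyspan Q d & forall x : R, is_derive x 1 q (d x)) ->
  (forall q, Q q -> rapid q) -> forall f, polyspan Q f -> rschwartz f.
Proof.
move=> DQ rQ f Qf.
have Dspan g : polyspan Q g ->
    exists2 d, polyspan Q d & forall x : R, is_derive x 1 g (d x).
  elim=> {g} [q /DQ//|f1 f2 Q1 [d1 Qd1 D1] Q2 [d2 Qd2 D2]|c f1 Q1 [d Qd D]|f1 Q1 [d Qd D]].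
  - by exists (fun x => d1 x + d2 x); [exact: polyspan_add|move=> x; exact: is_derive_add].
  - by exists (fun x => c * d x); [exact: polyspan_scale|move=> x; exact: is_derive_scale].
  - exists (fun x => f1 x + x * d x); first exact/polyspan_add/polyspan_mulx.
    move=> x; apply: (is_derive_ext (is_derive_mul (is_derive_id x 1) (D x))) => //.
    by rewrite mul1r.
have Qn n : polyspan Q (derive1n n f).
  elim: n => [//|n IH]; rewrite derive1nS.
  by have [d Qd /is_derive_funE ->] := Dspan _ IH.
split=> [n x|n]; last exact: (rapid_polyspan rQ).
have [d _ /(_ x) Dd] := Dspan _ (Qn n); exact: ex_derive.
Qed.

Lemma rschwartz_deriv f : rschwartz f -> rschwartz (derive1 f).
Proof. by move=> [df rf]; split=> n; rewrite -derive1Sn. Qed.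

Lemma rschwartz_derivn f n : rschwartz f -> rschwartz (derive1n n f).
Proof. by move=> Sf; elim: n => [//|n /rschwartz_deriv]; rewrite -derive1nS. Qed.

Lemma rschwartz_is_derive f : rschwartz f -> forall x : R, is_derive x 1 f ((derive1 f) x).
Proof. by move=> [/(_ 0%N) df _] x; rewrite derive1E; exact/derivableP/df. Qed.

Lemma rschwartz_rapid f : rschwartz f -> rapid f.
Proof. by case=> _ /(_ 0%N). Qed.

Lemma rschwartz_continuous f : rschwartz f -> continuous f.
Proof.
move=> [/(_ 0%N) df _] x; apply: differentiable_continuous.
exact/derivable1_diffP/df.
Qed.

Lemma rschwartz_polyspan f : polyspan rschwartz f -> rschwartz f.
Proof.
apply: polyspan_schwartz => [q Sq|q /rschwartz_rapid//].
exists (derive1 q); first exact/polyspan_base/rschwartz_deriv.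
exact: rschwartz_is_derive.
Qed.

Lemma rschwartz_add f g : rschwartz f -> rschwartz g ->
  rschwartz (fun x => f x + g x).
Proof. by move=> Sf Sg; apply/rschwartz_polyspan/polyspan_add; exact: polyspan_base. Qed.

Lemma rschwartz_scale (c : R) f : rschwartz f -> rschwartz (fun x => c * f x).
Proof. by move=> Sf; exact/rschwartz_polyspan/polyspan_scale/polyspan_base. Qed.

Lemma rschwartz_mulx f : rschwartz f -> rschwartz (fun x => x * f x).
Proof. by move=> Sf; exact/rschwartz_polyspan/polyspan_mulx/polyspan_base. Qed.

Lemma rschwartz_neg f : rschwartz f -> rschwartz (fun x => f (- x)).
Proof.
move=> Sf; pose Q q := exists2 g, rschwartz g & q = (fun x => g (- x)).
apply: (@polyspan_schwartz Q) (polyspan_base _); last by exists f.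
- move=> q [g Sg ->]; exists (fun x => - 1 * (derive1 g) (- x)).
    apply/polyspan_scale/polyspan_base; exists (derive1 g) => //.
    exact: rschwartz_deriv.
  move=> x; rewrite mulrC.
  exact: (is_derive1_comp (rschwartz_is_derive Sg (- x))).
- move=> q [g /rschwartz_rapid rg ->] k; have [C H] := rg k.
  by exists C => x; have := H (- x); rewrite normrN.
Qed.

End RealSchwartz.

(** * Integrals over the half-line *)

Section HalfLineIntegral.
Context {R : realType}.
Local Notation mu := (@lebesgue_measure R).
Local Notation half := (`]0, +oo[%classic : set R).
Implicit Types (f g F : R -> R) (x y a b : R).

Lemma halfE x : half x <-> 0 < x.
Proof. by rewrite /= in_itv/= andbT. Qed.

Lemma measurable_half_continuous f : (forall x, 0 < x -> {for x, continuous f}) ->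
  measurable_fun half f.
Proof.
move=> cf; apply: open_continuous_measurable_fun; first exact: interval_open.
by move=> x /set_mem/halfE; exact: cf.
Qed.

Lemma dominated_integrable (D : set R) f g : measurable D -> measurable_fun D f ->
  (forall x, D x -> `|f x| <= g x) -> mu.-integrable D (EFin \o g) ->
  mu.-integrable D (EFin \o f).
Proof.
move=> mD mf fg; apply: le_integrable => //; first exact/measurable_EFinP.
move=> x Dx /=; rewrite lee_fin (le_trans (fg _ Dx))//.
exact: ler_norm.
Qed.

Lemma is_derive_under_integral (f df : R -> R -> R) (D : set R) g a r :
  measurable D -> 0 < r ->
  (forall x, `|x - a| < r -> mu.-integrable D (EFin \o f x)) ->
  (forall x y, `|x - a| < r -> D y -> is_derive x 1 (f^~ y) (df x y)) ->
  mu.-integrable D (EFin \o g) ->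
  (forall x y, `|x - a| < r -> D y -> `|df x y| <= g y) ->
  is_derive a 1 (fun x => \int[mu]_(y in D) f x y) (\int[mu]_(y in D) df a y).
Proof.
move=> mD r0 intf Df intg dfg.
have near x : `]a - r, a + r[%classic x -> `|x - a| < r.
  by rewrite /= in_itv/= ltr_norml => /andP[? ?]; apply/andP; split; lra.
have ballaa : `]a - r, a + r[%classic a by rewrite /= in_itv/=; apply/andP; split; lra.
have intf' x : `]a - r, a + r[%classic x -> mu.-integrable D (EFin \o f x).
  by move/near; exact: intf.
have derf x y : `]a - r, a + r[%classic x -> D y -> derivable (f^~ y) x 1.
  by move=> /near xa Dy; have Dx := Df _ _ xa Dy; exact: ex_derive.
have partialE x y : `]a - r, a + r[%classic x -> D y -> partial1of2 f x y = df x y.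
  move=> /near xa Dy; have Dx := Df _ _ xa Dy.
  by rewrite partial1of2E derive_val.
(* Differentiation under the integral asks for a bound that is nonnegative everywhere, whereas [g]
   is controlled on [D] only; its absolute value serves instead. *)
have g0 y : 0 <= `|g y| by [].
have intg' : mu.-integrable D (EFin \o (fun y => `|g y|)) by exact: integrable_norm.
have ub x y : `]a - r, a + r[%classic x -> D y -> `|partial1of2 f x y| <= `|g y|.
  move=> xa Dy; rewrite partialE// (le_trans _ (ler_norm _))//.
  by apply: dfg => //; exact: near.
apply: DeriveDef.
  exact: (@derivable_under_integral _ _ _ mu _ _ mD _ _ _ ballaa intf' derf _ g0 intg' ub).
rewrite -derive1E (@differentiation_under_integral _ _ _ mu _ _ mD _ _ _ ballaa intf' derf _ g0 intg' ub).
by apply: eq_Rintegral => y /set_mem Dy; exact: partialE.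
Qed.

(** Dominated convergence for the restrictions of [f], with [|f|] as bound: a given positive point
    lies in all but finitely many segments. Half-line integrals thus reduce to segments away from 0,
    where real powers are smooth. *)
Lemma cvg_half_exhaustion f (a b : nat -> R) :
  (forall n, 0 < a n) -> a @ \oo --> 0 -> b @ \oo --> +oo ->
  mu.-integrable half (EFin \o f) ->
  (\int[mu]_(x in `[a n, b n]) f x) @[n --> \oo] --> \int[mu]_(x in half) f x.
Proof.
move=> a0 cva cvb intf.
have sub n : half `&` `[a n, b n] = `[a n, b n]%classic.
  apply/seteqP; split=> [x []//|x Ix]; split=> //; apply/halfE.
  by move: Ix; rewrite /= in_itv/= => /andP[ax _]; exact: lt_le_trans (a0 n) ax.
rewrite /Rintegral; apply: fine_cvg; rewrite fineK; last exact: integrable_fin_num.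
under eq_cvg do rewrite -sub integral_mkcondr.
have [mf _] := integrableP _ _ _ intf.
apply: (@dominated_cvg _ _ _ mu _ _ _ _ (fun x => `|f x|%:E)) => //.
- move=> n; apply/measurable_restrict => //.
  exact: (measurable_funS (measurable_itv _) (@subIsetl _ _ _) mf).
- move=> x /halfE x0; apply: cvg_near_cst; near=> n.
  rewrite patchE mem_set//= in_itv/=; apply/andP; split.
    near: n; apply: (cvgr_le 0) => //.
  by near: n; move/cvgryPge : cvb; exact.
- exact: integrable_norm.
- move=> n x _; rewrite patchE; case: ifPn => _ //=.
  by rewrite normr0 lee_fin.
Unshelve. all: by end_near. Qed.

Lemma cvg_invS : (fun n : nat => n.+1%:R^-1 : R) @ \oo --> 0.
Proof. exact: cvg_harmonic. Qed.

Lemma cvg_natS2 : (fun n : nat => n.+2%:R : R) @ \oo --> +oo.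
Proof.
apply/cvgryPge => M; near=> n.
rewrite (@le_trans _ _ n%:R)// ?ler_nat; last by rewrite -addn2 leq_addr.
by near: n; exact: nbhs_infty_ger.
Unshelve. all: by end_near. Qed.

(** The right end is n + 2 rather than n + 1 so that the segment is nondegenerate for n = 0 too. *)
Lemma invS_lt_natS2 (n : nat) : n.+1%:R^-1 < n.+2%:R :> R.
Proof.
rewrite (@le_lt_trans _ _ 1)//; first by rewrite invf_le1 ?ler1n ?ltr0n.
by rewrite ltr1n.
Qed.

Lemma FTC2_pos F f a b : 0 < a -> a < b ->
  (forall x, 0 < x -> is_derive x 1 F (f x)) ->
  (forall x, 0 < x -> {for x, continuous f}) ->
  (\int[mu]_(x in `[a, b]) (f x)%:E = (F b - F a)%:E)%E.
Proof.
move=> a0 ab DF cf.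
have dF x : 0 < x -> derivable F x 1 by move=> /DF ?; exact: ex_derive.
have cF x : 0 < x -> {for x, continuous F}.
  by move=> /dF /derivable1_diffP ?; exact: differentiable_continuous.
have pos x : a <= x -> 0 < x by exact: lt_le_trans.
rewrite EFinB; apply: continuous_FTC2 => //.
- apply: continuous_in_subspaceT => x /set_mem; rewrite /= in_itv/= => /andP[+ _].
  by move=> /pos; exact: cf.
- split.
  + by move=> x; rewrite in_itv/= => /andP[+ _] => /ltW/pos; exact: dF.
  + by apply: cvg_at_right_filter; apply: cF; exact: pos.
  + by apply: cvg_at_left_filter; apply: cF; apply: pos; exact: ltW.
- move=> x; rewrite in_itv/= => /andP[+ _] => /ltW/pos x0.
  by rewrite derive1E; have Dx := DF _ x0; rewrite derive_val.
Qed.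

Lemma half_FTC F f (l0 l1 : R) :
  (forall x, 0 < x -> is_derive x 1 F (f x)) ->
  (forall x, 0 < x -> {for x, continuous f}) ->
  mu.-integrable half (EFin \o f) ->
  F x @[x --> 0^'+] --> l0 -> F x @[x --> +oo] --> l1 ->
  \int[mu]_(x in half) f x = l1 - l0.
Proof.
move=> DF cf intf F0 F1.
have inv0 n : 0 < n.+1%:R^-1 :> R by rewrite invr_gt0.
have := cvg_half_exhaustion inv0 cvg_invS cvg_natS2 intf.
under eq_cvg do rewrite /Rintegral (FTC2_pos (inv0 _) (invS_lt_natS2 _) DF cf)/=.
move/cvg_lim => <- //; apply/cvg_lim => //; apply: cvgB.
  move/cvg_pinftyP : F1; apply; exact: cvg_natS2.
move/cvg_at_rightP : F0; apply; split => //; exact: cvg_invS.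
Qed.

(** On each segment of the exhaustion the integral is a difference of two values of [F], hence at
    most [M]; monotone convergence carries this bound to the half-line. No limit of [F] need be
    known. *)
Lemma half_integrable_antiderivative F f (M : R) :
  (forall x, 0 < x -> is_derive x 1 F (f x)) ->
  (forall x, 0 < x -> {for x, continuous f}) ->
  (forall x, 0 < x -> 0 <= f x) -> (forall x, 0 < x -> 0 <= F x <= M) ->
  mu.-integrable half (EFin \o f).
Proof.
move=> DF cf f0 FM; have mf := measurable_half_continuous cf.
pose I (n : nat) : set R := `[n.+1%:R^-1, n.+2%:R]%classic.
have inv0 n : 0 < n.+1%:R^-1 :> R by rewrite invr_gt0.
have Ihalf n : I n `<=` half.
  move=> x; rewrite /I /= in_itv/= => /andP[ax _]; apply/halfE.
  exact: lt_le_trans (inv0 n) ax.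
have bigI : \bigcup_i I i = half.
  apply/seteqP; split=> [x [n _ /Ihalf//]|x /halfE x0].
  suff [n _ In] : \forall n \near \oo, I n x by exists n => //; exact: (In n (leqnn n)).
  near=> n; rewrite /I /= in_itv/=; apply/andP; split.
    by near: n; apply: (cvgr_le 0) => //; exact: cvg_invS.
  by near: n; move/cvgryPge : cvg_natS2; exact.
have mI n : measurable (I n) by exact: measurable_itv.
apply/integrableP; split; first exact/measurable_EFinP.
have cvgI : (\int[mu]_(x in I i) `|(f x)%:E| @[i --> \oo] -->
    \int[mu]_(x in half) `|(f x)%:E|)%E.
  rewrite -bigI; apply: ge0_nondecreasing_set_cvg_integral => //.
  - apply/nondecreasing_seqP => n; rewrite subsetEset => x.
    rewrite /I /= !in_itv/= => /andP[ax bx]; apply/andP; split.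
      by rewrite (le_trans _ ax)// lef_pV2 ?posrE// ler_nat.
    by rewrite (le_trans bx)// ler_nat.
  - move=> n; apply/measurable_EFinP/measurableT_comp => //.
    exact: measurable_funS mf.
rewrite (@le_lt_trans _ _ M%:E) ?ltry//.
apply: (cvge_le _ cvgI); near=> n.
have -> : (\int[mu]_(x in I n) `|(f x)%:E| = \int[mu]_(x in I n) (f x)%:E)%E.
  by apply: eq_integral => x /set_mem/Ihalf/halfE x0 /=; rewrite ger0_norm ?f0.
rewrite (FTC2_pos (inv0 _) (invS_lt_natS2 _) DF cf) lee_fin.
have /andP[Fa _] := FM _ (inv0 n).
have /andP[_ Fb] := FM n.+2%:R (ltr0Sn _ _).
lra.
Unshelve. all: by end_near. Qed.
End HalfLineIntegral.

(** * Power weights and the Gamma function *)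

Section WeightsAndGamma.
Context {R : realType}.
Local Notation mu := (@lebesgue_measure R).
Local Notation half := (`]0, +oo[%classic : set R).
Implicit Types (f g h F : R -> R) (x y p s t : R).

(** With y = |x|^k this is y <= 1 + y^2. It recovers all powers from powers of x^2, the only ones
    estimated directly for the Gaussian and for the transforms. *)
Lemma exprn_norm_le1Dsqr x (k : nat) : `|x| ^+ k <= 1 + (x ^+ 2) ^+ k.
Proof.
have -> : (x ^+ 2) ^+ k = `|x| ^+ k * `|x| ^+ k.
  by rewrite -real_normK ?num_real// -exprMn -expr2.
have := exprn_ge0 k (normr_ge0 x); move: (`|x| ^+ k) => y y0.
by have [y1|y1] := leP y 1; nra.
Qed.

Lemma integrable_scale (D : set R) (c : R) f : measurable D ->
  mu.-integrable D (EFin \o f) -> mu.-integrable D (EFin \o (fun x => c * f x)).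
Proof. by move=> mD intf; exact: (@integrableZl _ _ _ mu D mD c _ intf). Qed.

Lemma integrable_add (D : set R) f g : measurable D ->
  mu.-integrable D (EFin \o f) -> mu.-integrable D (EFin \o g) ->
  mu.-integrable D (EFin \o (fun x => f x + g x)).
Proof. by move=> mD intf intg; exact: (@integrableD _ _ _ mu D mD _ _ intf intg). Qed.

Lemma powR_pD x (r s : R) : 0 < x -> x `^ (r + s) = x `^ r * x `^ s.
Proof. by move=> x0; apply: powRD; apply/implyP => _; rewrite gt_eqF. Qed.

Lemma is_derive_inv f x (df : R) : f x != 0 -> is_derive x 1 f df ->
  is_derive x 1 (fun y => (f y)^-1) (- df / f x ^+ 2).
Proof.
move=> fx0 Df; apply: (is_derive_eq (is_deriveV fx0 Df)).
by rewrite /GRing.scale /= mulNr mulrC mulNr.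
Qed.

Lemma is_derive_comp f g x (df dg : R) : is_derive x 1 g dg ->
  is_derive (g x) 1 f df -> is_derive x 1 (fun y => f (g y)) (df * dg).
Proof. by move=> Dg Df; exact: is_derive1_comp. Qed.

Lemma is_derive_powR_comp f p x (df : R) : is_derive x 1 f df -> 0 < f x ->
  is_derive x 1 (fun y => f y `^ p) (p * f x `^ (p - 1) * df).
Proof. by move=> Df fx0; exact: is_derive_comp Df (is_derive1_powR p fx0). Qed.

Lemma is_derive_continuous f x (df : R) : is_derive x 1 f df -> {for x, continuous f}.
Proof.
move=> Df; apply: differentiable_continuous; apply/derivable1_diffP.
exact: ex_derive.
Qed.

Definition half_rapid f := forall k : nat, exists C, forall x, 0 < x -> x ^+ k * `|f x| <= C.

Lemma rapid_half_rapid f : rapid f -> half_rapid f.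
Proof. by move=> rf k; have [C H] := rf k; exists C => x x0; have := H x; rewrite gtr0_norm. Qed.

Lemma half_rapid_mul f g (A : R) (m : nat) : half_rapid f ->
  (forall x, 0 < x -> `|g x| <= A * (1 + x ^+ m)) -> half_rapid (fun x => g x * f x).
Proof.
move=> rf gA k; have [C1 H1] := rf k; have [C2 H2] := rf (m + k)%N.
exists (`|A| * (C1 + C2)) => x x0.
have xk j : 0 <= x ^+ j by rewrite exprn_ge0// ltW.
have gA' : `|g x| <= `|A| * (1 + x ^+ m).
  by rewrite (le_trans (gA _ x0))// ler_wpM2r ?addr_ge0// ler_norm.
rewrite normrM mulrCA (le_trans (ler_wpM2r _ gA'))// ?mulr_ge0//.
rewrite -mulrA ler_wpM2l// mulrDl mul1r mulrA -exprD.
by rewrite lerD// ?H1// H2.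
Qed.

Lemma half_rapid_1Dx f (k : nat) : half_rapid f ->
  exists C, forall x, 0 < x -> (1 + x) ^+ k * `|f x| <= C.
Proof.
move=> rf; suff /(_ 0%N)[C H] : half_rapid (fun x => (1 + x) ^+ k * f x).
  exists C => x x0; have := H x x0; rewrite expr0 mul1r normrM ger0_norm//.
  by rewrite exprn_ge0// addr_ge0// ltW.
elim: k => [|k IH]; first by under eq_fun do rewrite expr0 mul1r.
under eq_fun do rewrite exprS -mulrA.
apply: (half_rapid_mul (A := 1) (m := 1) IH) => x x0.
by rewrite mul1r expr1 ger0_norm// addr_ge0// ltW.
Qed.

(** Since x/(1+x) has derivative 1/(1+x)^2, the integrand is the derivative of
    (x/(1+x))^(p+1)/(p+1), which stays between 0 and 1/(p+1). It behaves like x^p at 0 and like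
    x^(-2) at infinity, so this single weight dominates at both ends. *)
Lemma weight_integrable p : -1 < p ->
  mu.-integrable half (EFin \o (fun x => (x / (1 + x)) `^ p / (1 + x) ^+ 2)).
Proof.
move=> p1; have p0 : 0 < p + 1 by lra.
have u1 x : 0 < x -> 0 < 1 + x by move=> x0; lra.
have u0 x : 0 < x -> 0 < x / (1 + x) by move=> x0; rewrite divr_gt0 ?u1.
have D1 x : is_derive x 1 (fun y => 1 + y) 1.
  exact (is_derive_ext (is_derive_add (is_derive_cst (1:R) x 1) (is_derive_id x 1)) (fun=> erefl) (add0r 1)).
have Du x : 0 < x -> is_derive x 1 (fun y => y / (1 + y)) (((1 + x) ^+ 2)^-1).
  move=> x0; have x1 := lt0r_neq0 (u1 _ x0).
  apply: (is_derive_eq (is_derive_mul (is_derive_id x 1) (is_derive_inv x1 (D1 x)))).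
  by field.
apply: (@half_integrable_antiderivative _
    (fun x => (p + 1)^-1 * (x / (1 + x)) `^ (p + 1)) _ (p + 1)^-1) => x x0.
- apply: (is_derive_eq (is_derive_scale _
    (is_derive_powR_comp (p + 1) (Du _ x0) (u0 _ x0)))).
  rewrite addrK; field.
  by rewrite !lt0r_neq0 ?u1.
- have Dp := is_derive_powR_comp p (Du _ x0) (u0 _ x0).
  apply: (is_derive_continuous (is_derive_mul Dp
    (is_derive_inv _ (is_derive_mul (D1 x) (D1 x))))).
  by rewrite mulf_neq0// gt_eqF// u1.
- by rewrite divr_ge0 ?powR_ge0// exprn_ge0// ltW// u1.
- have ip : 0 <= (p + 1)^-1 by rewrite invr_ge0 ltW.
  have u1' : x / (1 + x) <= 1 by rewrite ler_pdivrMr ?u1// mul1r; lra.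
  apply/andP; split; first by rewrite mulr_ge0 ?powR_ge0.
  rewrite -[X in _ <= X]mulr1 ler_wpM2l//.
  have u01 : 0 < x / (1 + x) <= 1 by rewrite u0.
  by have := ger_powR u01 (ltW p0); rewrite powRr0.
Qed.

Lemma half_rapid_integrable p f : -1 < p -> half_rapid f -> measurable_fun half f ->
  mu.-integrable half (EFin \o (fun x => f x * x `^ p)).
Proof.
(* The quotient of x^p by the weight is (1+x)^(p+2), which the decay of [f] has to absorb. *)
move=> p1 rf mf; have [k pk] : exists k : nat, p + 2 <= k%:R.
  exists (Num.truncn (p + 2)).+1; apply: ltW; apply: truncnS_gt.
have [C H] := half_rapid_1Dx k rf.
apply: (@dominated_integrable _ _ _
  (fun x => C * ((x / (1 + x)) `^ p / (1 + x) ^+ 2))) => //.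
- apply: measurable_funM => //.
  exact: (measurable_funS measurableT (@subsetT _ _) (measurable_powR p)).
- move=> x /halfE x0; have x1 : 0 < 1 + x by lra.
  have C0 : 0 <= C by apply: le_trans (H _ x0); rewrite mulr_ge0// exprn_ge0// ltW.
  have -> : (x / (1 + x)) `^ p / (1 + x) ^+ 2 = x `^ p / (1 + x) `^ (p + 2).
    rewrite powRM ?invr_ge0 ?ltW// -mulrA; congr (_ * _).
    rewrite -powR_inv1 ?ltW// -powRrM mulN1r powRN -invfM; congr _^-1.
    have e2 : (1 + x) `^ 2 = (1 + x) ^+ 2 by exact: (powR_mulrn 2 (ltW x1)).
    by rewrite -e2 -powR_pD.
  rewrite normrM (ger0_norm (powR_ge0 _ _)) mulrC mulrCA ler_wpM2l ?powR_ge0//.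
  rewrite ler_pdivlMr ?powR_gt0// mulrC (le_trans _ (H _ x0))// ler_wpM2r//.
  by rewrite -(powR_mulrn k (ltW x1)) ler_powR//; lra.
- exact/integrable_scale/weight_integrable.
Qed.

(** * The exponential and the Gamma function *)

Lemma half_rapid_expRN : half_rapid (fun x => expR (- x)).
Proof.
case=> [|k].
  by exists 1 => x x0; rewrite expr0 mul1r ger0_norm ?expR_ge0// expR_le1; lra.
(* The constant comes from one term of the exponential series: x^(k+1)/(k+1)! <= exp x. *)
exists k.+1`!%:R => x x0; rewrite ger0_norm ?expR_ge0// expRN.
rewrite ler_pdivrMr ?expR_gt0// mulrC -ler_pdivrMr ?ltr0n ?fact_gt0//.
by apply: le_trans (expR_ge1Dxn k (ltW x0)); rewrite lerDr.
Qed.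

Lemma is_derive_expRN x : is_derive x 1 (fun y => expR (- y)) (- expR (- x)).
Proof.
apply: (is_derive_ext (is_derive1_comp (is_derive_expR (- x)) (is_deriveNid x 1))) => //.
by rewrite mulrN1.
Qed.

Lemma measurable_expRN : measurable_fun half (fun x => expR (- x)).
Proof. by apply: measurable_half_continuous => x _; exact: is_derive_continuous (is_derive_expRN x). Qed.

Lemma Gamma_integrable s : 0 < s ->
  mu.-integrable half (EFin \o (fun t => t `^ (s - 1) * expR (- t))).
Proof.
move=> s0; have -> : (fun t => t `^ (s - 1) * expR (- t)) = (fun t => expR (- t) * t `^ (s - 1)).
  by apply/funext => t; rewrite mulrC.
by apply: half_rapid_integrable half_rapid_expRN measurable_expRN; lra.
Qed.

Lemma half_rapid_cvgy f p : half_rapid f -> (f x * x `^ p) @[x --> +oo] --> 0.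
Proof.
(* One power more than [p] leaves the bound C/x for x >= 1. *)
move=> rf; have [k pk] : exists k : nat, p + 1 <= k%:R.
  exists (Num.truncn (p + 1)).+1; apply: ltW; apply: truncnS_gt.
have [C H] := rf k.
apply/cvgr0Pnorm_le => e e0; near=> x.
have x1 : 1 <= x by near: x; exact: nbhs_pinfty_ge.
have x0 : 0 < x by lra.
rewrite normrM (ger0_norm (powR_ge0 _ _)).
have Cx : C / x <= e by rewrite ler_pdivrMr// mulrC -ler_pdivrMr.
apply: le_trans Cx; rewrite ler_pdivlMr// -mulrA (le_trans _ (H _ x0))// mulrC ler_wpM2r//.
rewrite -[X in _ * X](powRr1 (ltW x0)) -powR_pD//.
by rewrite -(powR_mulrn k (ltW x0)) ler_powR.
Unshelve. all: by end_near. Qed.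

Lemma powR_bounded_cvg0 f p (C : R) : 0 < p -> (forall x, 0 < x <= 1 -> `|f x| <= C) ->
  (f x * x `^ p) @[x --> 0^'+] --> 0.
Proof.
move=> p0 fC; apply/cvgr0Pnorm_le => e e0.
have CC : 0 <= C by apply: le_trans (fC 1 _); rewrite ?ltr01 ?lexx.
(* The divisor is C + 1 because [C] may be 0. *)
have := powR_cvg0 p0 => /cvgr0Pnorm_le /(_ (e / (C + 1))) H.
near=> x.
have x0 : 0 < x by near: x; exact: nbhs_right_gt.
have x1 : x <= 1 by near: x; exact: nbhs_right_le.
have xp : `|x `^ p| <= e / (C + 1) by near: x; apply: H; rewrite divr_gt0//; lra.
rewrite normrM (le_trans (ler_pM _ _ (fC _ _) xp))// ?x0//.
rewrite mulrC -mulrA ler_piMr//; first exact: ltW.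
by rewrite mulrC ler_pdivrMr; lra.
Unshelve. all: by end_near. Qed.

(** Integration by parts: exp(-t) t^s vanishes at both ends, and its derivative is the difference of
    the two integrands. *)
Lemma GammaS s : 0 < s -> Gamma (s + 1) = s * Gamma s.
Proof.
move=> s0; pose F t : R := expR (- t) * t `^ s.
pose g1 t : R := t `^ (s - 1) * expR (- t).
pose g2 t : R := t `^ (s + 1 - 1) * expR (- t).
have i1 : mu.-integrable half (EFin \o g1) by exact: Gamma_integrable.
have i2 : mu.-integrable half (EFin \o g2) by apply: Gamma_integrable; lra.
have i1' : mu.-integrable half (EFin \o (fun t => s * g1 t)).
  exact: integrable_scale.
have DF t : 0 < t -> is_derive t 1 F (s * g1 t - g2 t).
  move=> t0; apply: (is_derive_eq (is_derive_mul (is_derive_expRN t) (is_derive1_powR s t0))).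
  by rewrite /g1 /g2 addrK; ring.
have cg p t : 0 < t -> {for t, continuous (fun t : R => t `^ p * expR (- t))}.
  move=> t0; exact: is_derive_continuous
    (is_derive_mul (is_derive1_powR p t0) (is_derive_expRN t)).
have := @half_FTC _ F (fun t => s * g1 t - g2 t) 0 0 DF.
rewrite RintegralB// RintegralZl// subr0 => H; apply/esym/eqP; rewrite -subr_eq0.
apply/eqP/H.
- move=> t t0; apply: cvgB; last exact: cg.
  by apply: cvgM; [exact: cvg_cst|exact: cg].
- exact: (@integrableB _ _ _ mu half (measurable_itv _) _ _ i1' i2).
- apply: (@powR_bounded_cvg0 _ _ 1) => // x /andP[x0 _].
  by rewrite ger0_norm ?expR_ge0// expR_le1; lra.
- exact: half_rapid_cvgy half_rapid_expRN.
Qed.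

(** For an argument p >= 1 the integrand is at least exp(-2) on [1, 2], since t^(p-1) >= 1 there.
    The functional equation reduces any s > 0 to s + 1. *)
Lemma Gamma_gt0 s : 0 < s -> 0 < Gamma s.
Proof.
move=> s0; suff G1 p : 1 <= p -> 0 < Gamma p.
  by have := G1 (s + 1); rewrite GammaS// pmulr_rgt0//; apply; lra.
move=> p1; pose A : set R := `[1, 2]%classic.
have Ahalf : A `<=` half.
  by move=> x; rewrite /A /= in_itv/= => /andP[x1 _]; apply/halfE; lra.
have halfA : half `&` A = A by apply: setIidr.
have iA : mu.-integrable half (EFin \o ((cst (expR (- 2))) \_ A)).
  rewrite -restrict_EFin; apply/integrable_restrict => //; first exact: measurable_itv.
  rewrite halfA.
  apply: continuous_compact_integrable; first exact: segment_compact.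
  by apply: continuous_subspaceT => x; exact: cvg_cst.
apply: (@lt_le_trans _ _ (\int[mu]_(x in half) ((cst (expR (- 2))) \_ A) x)).
  rewrite -Rintegral_mkcondr halfA Rintegral_cst//=.
  by rewrite lebesgue_measure_itv/= lte_fin ltrDl ltr01 /= mulr_gt0 ?expR_gt0//; lra.
  exact: measurable_itv.
rewrite /Gamma; apply: (@le_Rintegral _ _ _ mu half) => //; first by apply: Gamma_integrable; lra.
move=> x /halfE x0; rewrite patchE; case: ifPn => [/set_mem|_]; last first.
  by rewrite mulr_ge0 ?powR_ge0 ?expR_ge0.
rewrite /A /= in_itv/= => /andP[x1 x2].
have e1 : expR (- 2) <= expR (- x) by rewrite ler_expR; lra.
have p0 : 0 <= p - 1 by lra.
have := ler_powR x1 p0; rewrite powRr0 => xp.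
by rewrite -[leLHS]mul1r ler_pM ?expR_ge0.
Qed.

End WeightsAndGamma.

(** * The Gaussian *)

Section Gaussian.
Context {R : realType}.
Local Notation mu := (@lebesgue_measure R).
Local Notation half := (`]0, +oo[%classic : set R).
Implicit Types (f g h F : R -> R) (x y p s t : R).

Definition gauss x : R := expR (- (x ^+ 2 / 2)).

Lemma gauss_gt0 x : 0 < gauss x. Proof. exact: expR_gt0. Qed.

Lemma gaussN x : gauss (- x) = gauss x.
Proof. by rewrite /gauss sqrrN. Qed.

Lemma is_derive_halfsqr x : is_derive x 1 (fun y => y ^+ 2 / 2) x.
Proof.
have D := is_derive_scale 2^-1 (is_derive_mul (is_derive_id x 1) (is_derive_id x 1)).
apply: (is_derive_ext D) => [y|] /=; first by rewrite expr2 mulrC.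
by field.
Qed.

Lemma is_derive_gauss x : is_derive x 1 gauss (- x * gauss x).
Proof.
have D := is_derive_comp (is_derive_halfsqr x) (is_derive_expRN (x ^+ 2 / 2)).
by apply: (is_derive_eq D); rewrite mulrC mulrN mulNr.
Qed.

Lemma rapid_gauss : rapid gauss.
Proof.
(* The [1] bounds the Gaussian itself, and [2 ^+ k * C] bounds its product with x^(2k): the decay of
   exp(-t) is used at t = x^2/2, so that x^(2k) = 2^k t^k. *)
move=> k; have [C H] := @half_rapid_expRN R k; exists (1 + 2 ^+ k * C) => x.
have g0 := gauss_gt0 x; rewrite (gtr0_norm g0).
have C0 : 0 <= C by apply: le_trans (H 1 ltr01); rewrite mulr_ge0// exprn_ge0.
(* The decay of exp(-t) is known for t > 0 only, so x = 0 is settled by hand. *)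
have [->|x0] := eqVneq x 0.
  rewrite normr0 expr0n /gauss expr0n/= mul0r oppr0 expR0 mulr1.
  have : 0 <= 2 ^+ k * C by rewrite mulr_ge0// exprn_ge0.
  by case: (k == 0)%N => /=; lra.
have x2 : 0 < x ^+ 2 / 2 by rewrite divr_gt0// exprn_even_gt0.
have g1 : gauss x <= 1 by rewrite expR_le1; lra.
have := H _ x2; rewrite (gtr0_norm (expR_gt0 _)) -/(gauss x) => Hx.
have Hx' : (x ^+ 2) ^+ k * gauss x <= 2 ^+ k * C.
  rewrite -(divfK (_ : 2 != 0) (x ^+ 2))// exprMn -mulrA mulrCA [_ ^+ k * (_ * _)]mulrCA.
  by rewrite mulrCA ler_wpM2l// ?exprn_ge0.
by rewrite (le_trans (ler_wpM2r (ltW g0) (exprn_norm_le1Dsqr x k)))// mulrDl mul1r lerD.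
Qed.

Lemma rschwartz_gauss : rschwartz gauss.
Proof.
apply: (@polyspan_schwartz _ (eq gauss)) (polyspan_base erefl) => _ <-; last first.
  exact: rapid_gauss.
exists (fun x => -1 * (x * gauss x)); first exact/polyspan_scale/polyspan_mulx/polyspan_base.
by move=> x; apply: (is_derive_ext (is_derive_gauss x)); rewrite ?mulN1r ?mulNr.
Qed.

(** The substitution t = x^2/2, dt = x dx turns the Gamma integrand t^nu exp(-t) into 2^(-nu) times
    the Gaussian integrand. It is carried out on segments and passed to the limit along two matching
    exhaustions. *)
Lemma Rintegral_gauss nu : -1 < nu ->
  \int[mu]_(x in half) (gauss x * x `^ (2 * nu + 1)) = 2 `^ nu * Gamma (nu + 1).
Proof.
move=> nu1; pose G t : R := t `^ (nu + 1 - 1) * expR (- t).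
pose W x : R := gauss x * x `^ (2 * nu + 1).
have iG : mu.-integrable half (EFin \o G) by apply: Gamma_integrable; lra.
have iW : mu.-integrable half (EFin \o W).
  apply: half_rapid_integrable; first lra.
  - exact/rapid_half_rapid/rapid_gauss.
  - by apply: measurable_half_continuous => x _; exact: is_derive_continuous (is_derive_gauss x).
pose F x : R := x ^+ 2 / 2.
have F0 x : 0 < x -> 0 < F x by move=> x0; rewrite divr_gt0// exprn_gt0.
have cG t : 0 < t -> {for t, continuous G}.
  move=> t0; exact: is_derive_continuous
    (is_derive_mul (is_derive1_powR _ t0) (is_derive_expRN t)).
have DF : derive1 F = id by apply: is_derive_funE; exact: is_derive_halfsqr.
have cF : continuous F by move=> x; exact: is_derive_continuous (is_derive_halfsqr x).
have sub a b : 0 < a -> a < b ->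
    \int[mu]_(x in `[F a, F b]) G x = 2 `^ (- nu) * \int[mu]_(x in `[a, b]) W x.
  move=> a0 ab; rewrite /Rintegral integration_by_substitution_increasing.
  - rewrite -/(Rintegral _ _ _) -RintegralZl//; last first.
      apply: (integrableS _ _ _ iW) => // x; rewrite /= in_itv/= => /andP[ax _].
      by apply/halfE; exact: lt_le_trans ax.
    apply: eq_Rintegral => x /set_mem; rewrite /= in_itv/= => /andP[ax _].
    have x0 : 0 < x by exact: lt_le_trans ax.
    have e : F x `^ nu * x = 2 `^ (- nu) * x `^ (2 * nu + 1).
      rewrite /F powRM ?exprn_ge0 ?invr_ge0 ?(ltW x0)//.
      rewrite -(powR_inv1 (ler0n _ 2)) -powRrM mulN1r mulrAC mulrC; congr (_ * _).
      by rewrite powR_pD// (powRr1 (ltW x0)) powRrM (powR_mulrn 2 (ltW x0)).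
    rewrite /W mulrCA -e /G addrK /gauss -/(F x).
    transitivity (F x `^ nu * expR (- F x) * x); first by rewrite DF.
    by rewrite mulrAC mulrC.
  - exact: ltW.
  - move=> x y; rewrite !in_itv/= => /andP[ax _] /andP[ay _] xy.
    by rewrite /F ltr_pM2r// ltrXn2r// ?nnegrE ltW// (lt_le_trans a0).
  - by rewrite DF => x _; exact: cvg_id.
  - by rewrite DF; apply/cvg_ex; exists a; apply: cvg_at_right_filter; exact: cvg_id.
  - by rewrite DF; apply/cvg_ex; exists b; apply: cvg_at_left_filter; exact: cvg_id.
  - split.
    + by move=> x _; have D := is_derive_halfsqr x; exact: ex_derive.
    + by apply: cvg_at_right_filter; exact: cF.
    + by apply: cvg_at_left_filter; exact: cF.
  - apply: continuous_in_subspaceT => x /set_mem; rewrite /= in_itv/= => /andP[ax _].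
    by apply: cG; exact: lt_le_trans (F0 _ a0) ax.
have inv0 (n : nat) : 0 < n.+1%:R^-1 :> R by rewrite invr_gt0.
have cvW := cvg_half_exhaustion inv0 cvg_invS cvg_natS2 iW.
have Fa : (fun n : nat => F n.+1%:R^-1) @ \oo --> 0.
  have -> : 0 = F 0 by rewrite /F expr0n mul0r.
  by apply: continuous_cvg; [exact: cF|exact: cvg_invS].
have Fb : (fun n : nat => F n.+2%:R) @ \oo --> +oo.
  apply/cvgryPge => M; move/cvgryPge : (@cvg_natS2 R) => /(_ M) H.
  near=> n; apply: (@le_trans _ _ n.+2%:R); first by near: n.
  by rewrite /F ler_pdivlMr// expr2 ler_wpM2l// ler_nat.
have cvG := cvg_half_exhaustion (fun n => F0 _ (inv0 n)) Fa Fb iG.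
have <- : 2 `^ (- nu) * \int[mu]_(x in half) W x = Gamma (nu + 1).
  rewrite /Gamma -/G; move/cvg_lim : cvG => <- //; apply/esym/cvg_lim => //.
  under eq_cvg do rewrite (sub _ _ (inv0 _) (invS_lt_natS2 _)).
  by apply: cvgM; [exact: cvg_cst|exact: cvW].
by rewrite mulrA -powR_pD// subrr powRr0 mul1r.
Unshelve. all: by end_near. Qed.

End Gaussian.

(** * Dividing Schwartz functions *)

Section Quotient.
Context {R : realType}.
Local Notation mu := (@lebesgue_measure R).
Local Notation unit_itv := (`[0, 1]%classic : set R).
Implicit Types (f g u h F : R -> R) (x y a s t : R).

Lemma unit_itvE t : unit_itv t <-> 0 <= t <= 1.
Proof. by rewrite /= in_itv/=. Qed.

Lemma measure_unit_itv : fine (mu unit_itv) = 1.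
Proof. by rewrite lebesgue_measure_itv/= lte_fin ltr01 oppr0 addr0. Qed.

Lemma unit_itv_continuous_integrable f : continuous f ->
  mu.-integrable unit_itv (EFin \o f).
Proof.
move=> cf; apply: continuous_compact_integrable; first exact: segment_compact.
exact: continuous_subspaceT.
Qed.

Lemma unit_itv_FTC F f : (forall x, is_derive x 1 F (f x)) -> continuous f ->
  \int[mu]_(x in unit_itv) f x = F 1 - F 0.
Proof.
move=> DF cf; have cF : continuous F by move=> x; exact: is_derive_continuous (DF x).
rewrite /Rintegral (@continuous_FTC2 _ f F 0 1)//.
- exact: continuous_subspaceT.
- split.
  + by move=> x _; have Dx := DF x; exact: ex_derive.
  + by apply: cvg_at_right_filter; exact: cF.
  + by apply: cvg_at_left_filter; exact: cF.
- by move=> x _; rewrite (is_derive_funE DF).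
Qed.

Lemma is_derive_affine a x t : is_derive t 1 (fun s => a + s * (x - a)) (x - a).
Proof.
have D := is_derive_add (is_derive_cst a t 1) (is_derive_scale (x - a) (is_derive_id t 1)).
by apply: (is_derive_ext D) => [s|]; rewrite ?add0r ?mulr1// mulrC.
Qed.

Lemma is_derive_affine_point a t x : is_derive x 1 (fun y => a + t * (y - a)) t.
Proof.
have D := is_derive_add (is_derive_cst (a - t * a) x 1) (is_derive_scale t (is_derive_id x 1)).
by apply: (is_derive_ext D) => [s|]; rewrite ?add0r ?mulr1//=; ring.
Qed.

Variables (u : R -> R) (a : R).
Hypothesis (Su : rschwartz u).
Local Notation du n := (derive1n n u).

(* The [n]-th derivative of [x |-> (u x - u a) / (x - a)], in Hadamard's form. *)
Definition hadamard (n : nat) x : R :=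
  \int[mu]_(t in unit_itv) (t ^+ n * du n.+1 (a + t * (x - a))).

Lemma is_derive_hadamard_arg n x t :
  is_derive t 1 (fun s => du n (a + s * (x - a))) ((x - a) * du n.+1 (a + t * (x - a))).
Proof.
rewrite mulrC derive1nS.
exact: (is_derive1_comp (rschwartz_is_derive (rschwartz_derivn n Su) _) (is_derive_affine a x t)).
Qed.

Lemma is_derive_hadamard_point n t x :
  is_derive x 1 (fun y => du n (a + t * (y - a))) (t * du n.+1 (a + t * (x - a))).
Proof.
rewrite mulrC derive1nS.
exact: (is_derive1_comp (rschwartz_is_derive (rschwartz_derivn n Su) _) (is_derive_affine_point a t x)).
Qed.

Lemma is_derive_Xn (n : nat) t : is_derive t 1 (fun s => s ^+ n) (n%:R * t ^+ n.-1).
Proof.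
apply: DeriveDef; first exact: exprn_derivable.
by rewrite exp_derive /GRing.scale /= mulr1 mulr_natl.
Qed.

Lemma hadamard_continuous n m x : continuous (fun t => t ^+ n * du m (a + t * (x - a))).
Proof.
move=> t; exact: is_derive_continuous
  (is_derive_mul (is_derive_Xn n t) (is_derive_hadamard_arg m x t)).
Qed.

Lemma hadamard_integrand_bound n m (C : R) x t : (forall y, `|du m y| <= C) ->
  unit_itv t -> `|t ^+ n * du m (a + t * (x - a))| <= C.
Proof.
move=> duC /unit_itvE/andP[t0 t1]; rewrite normrM (le_trans _ (duC (a + t * (x - a))))//.
by rewrite ler_piMl// ger0_norm ?exprn_ge0// exprn_ile1.
Qed.

Lemma derivn_bounded n : exists C, forall y, `|du n y| <= C.
Proof.
have [C H] := rschwartz_rapid (rschwartz_derivn n Su) 0.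
by exists C => y; have := H y; rewrite expr0 mul1r.
Qed.

Lemma is_derive_hadamard n x : is_derive x 1 (hadamard n) (hadamard n.+1 x).
Proof.
have [C duC] := derivn_bounded n.+2.
apply: (@is_derive_under_integral _ (fun x t => t ^+ n * du n.+1 (a + t * (x - a)))
  (fun x t => t ^+ n.+1 * du n.+2 (a + t * (x - a))) unit_itv (cst C) x 1) => //.
- by move=> y _; apply: unit_itv_continuous_integrable; exact: hadamard_continuous.
- move=> y t _ _.
  apply: (is_derive_eq (is_derive_scale (t ^+ n) (is_derive_hadamard_point n.+1 t y))).
  by rewrite exprSr mulrA.
- by apply: unit_itv_continuous_integrable => t; exact: cvg_cst.
- by move=> y t _; exact: hadamard_integrand_bound.
Qed.

(** The fundamental theorem of calculus along the segment from [a] to [x], parametrized by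
    [0, 1]. *)
Lemma hadamard0 x : (x - a) * hadamard 0 x = u x - u a.
Proof.
have := unit_itv_FTC (is_derive_hadamard_arg 0 x).
rewrite mul1r mul0r addr0 (addrC a) subrK /= => <-; last first.
  move=> t; apply: cvgM; first exact: cvg_cst.
  exact: is_derive_continuous (is_derive_hadamard_arg 1 x t).
rewrite /hadamard -RintegralZl//.
  by apply: eq_Rintegral => t _; rewrite expr0 mul1r.
exact/unit_itv_continuous_integrable/hadamard_continuous.
Qed.

(** This is Leibniz's rule for the (n+1)-st derivative of (x - a) q(x), where q is the difference
    quotient. It is proved by integrating the derivative of t^(n+1) u^(n+1)(a + t(x-a)) over
    [0, 1]. *)
Lemma hadamardS n x :
  (x - a) * hadamard n.+1 x = du n.+1 x - n.+1%:R * hadamard n x.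
Proof.
pose f t := n.+1%:R * (t ^+ n * du n.+1 (a + t * (x - a)))
            + (x - a) * (t ^+ n.+1 * du n.+2 (a + t * (x - a))).
have DF t : is_derive t 1 (fun t => t ^+ n.+1 * du n.+1 (a + t * (x - a))) (f t).
  apply: (is_derive_eq (is_derive_mul (is_derive_Xn n.+1 t) (is_derive_hadamard_arg n.+1 x t))).
  rewrite /f /=; ring.
have cf : continuous f.
  move=> t; have D m k := is_derive_mul (is_derive_Xn m t) (is_derive_hadamard_arg k x t).
  exact: is_derive_continuous
    (is_derive_add (is_derive_scale _ (D n n.+1)) (is_derive_scale _ (D n.+1 n.+2))).
have := unit_itv_FTC DF cf.
rewrite expr1n expr0n mul0r subr0 !mul1r (addrC a) subrK => <-.
have iZ c m k : mu.-integrable unit_itv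
    (EFin \o (fun t => c * (t ^+ m * du k (a + t * (x - a))))).
  apply/integrable_scale/unit_itv_continuous_integrable/hadamard_continuous => //.
have i0 m k : mu.-integrable unit_itv
    (EFin \o (fun t => t ^+ m * du k (a + t * (x - a)))).
  exact/unit_itv_continuous_integrable/hadamard_continuous.
rewrite /f RintegralD// !RintegralZl// -/(hadamard n x) -/(hadamard n.+1 x).
by move: (hadamard _ _) (hadamard _ _) => b c; ring.
Qed.

Lemma hadamard_bounded n : exists C, forall x, `|hadamard n x| <= C.
Proof.
have [C duC] := derivn_bounded n.+1; exists C => x.
have i0 : mu.-integrable unit_itv
    (EFin \o (fun t => t ^+ n * du n.+1 (a + t * (x - a)))).
  exact/unit_itv_continuous_integrable/hadamard_continuous.
rewrite (le_trans (le_normr_Rintegral _ i0))//.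
have -> : C = \int[mu]_(t in unit_itv) cst C t.
  by rewrite Rintegral_cst// measure_unit_itv mulr1.
apply: (@le_Rintegral _ _ _ mu unit_itv) => //.
- exact: integrable_norm.
- by apply: unit_itv_continuous_integrable => t; exact: cvg_cst.
- by move=> t It; exact: hadamard_integrand_bound.
Qed.

(** Induction on the power [k], for all [n] at once. One factor |x| is at most |x - a| + |a|; the
    factor x - a is removed by [hadamard0] or [hadamardS], leaving a Schwartz function and a
    multiple of the preceding [hadamard], both under control at the power [k]. For n = 0 the
    constant u(a) would spoil the decay, hence the vanishing at [a]. *)
Lemma rapid_hadamard n : u a = 0 -> rapid (hadamard n).
Proof.
move=> ua0 k; elim: k n => [|k IH] n.
  by have [C H] := hadamard_bounded n; exists C => x; rewrite expr0 mul1r.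
suff [C1 H1] : exists C, forall x, `|x| ^+ k * `|(x - a) * hadamard n x| <= C.
  have [C2 H2] := IH n; exists (C1 + `|a| * C2) => x.
  have xa : `|x| <= `|x - a| + `|a| by rewrite -[X in `|X| <= _](subrK a) ler_normD.
  rewrite exprSr -mulrA mulrCA.
  rewrite (le_trans (ler_wpM2r _ xa)) ?mulr_ge0 ?exprn_ge0// mulrDl lerD//.
    by rewrite mulrCA -normrM.
  by rewrite ler_wpM2l.
case: n => [|n].
  have [C H] := rschwartz_rapid Su k.
  by exists C => x; rewrite hadamard0 ua0 subr0.
have [C1 H1] := rschwartz_rapid (rschwartz_derivn n.+1 Su) k.
have [C2 H2] := IH n; exists (C1 + n.+1%:R * C2) => x; rewrite hadamardS.
rewrite (le_trans (ler_wpM2l _ (ler_normB _ _))) ?exprn_ge0// mulrDr lerD//.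
by rewrite normrM mulrCA (ger0_norm (ler0n _ _)) ler_wpM2l.
Qed.

Lemma rschwartz_quotient : u a = 0 ->
  exists2 h, rschwartz h & forall x, u x = (x - a) * h x.
Proof.
move=> ua0; exists (hadamard 0); last by move=> x; rewrite hadamard0 ua0 subr0.
apply: (@polyspan_schwartz _ (fun q => exists n, q = hadamard n)) => [_ [n ->]|_ [n ->]|].
- exists (hadamard n.+1); first by apply: polyspan_base; exists n.+1.
  exact: is_derive_hadamard.
- exact: rapid_hadamard.
- by apply: polyspan_base; exists 0%N.
Qed.

End Quotient.

(** * Even Schwartz functions and their even quotients *)

Section EvenQuotient.
Context {R : realType}.
Implicit Types (f h : R -> R) (x y a : R).

Definition even_fun f := forall x, f (- x) = f x.

Definition eschwartz f := rschwartz f /\ even_fun f.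

(* Division may be made even by symmetrizing an arbitrary Schwartz quotient. *)
Lemma eschwartz_symmetrize h : rschwartz h ->
  eschwartz (fun x => 2^-1 * (h x + h (- x))).
Proof.
move=> Sh; split; first exact/rschwartz_scale/rschwartz_add/rschwartz_neg.
by move=> x; rewrite opprK addrC.
Qed.

(** The derivative of an even function is odd, hence vanishes at 0 and is divisible by x. The
    resulting [h] is [- D f]. *)
Lemma eschwartz_deriv_quotient f : eschwartz f ->
  exists2 h, eschwartz h & forall x, derive1 f x = x * h x.
Proof.
move=> [Sf ef]; have D := rschwartz_is_derive Sf.
have odd x : derive1 f (- x) = - derive1 f x.
  have D1 : is_derive x 1 (fun y => f (- y)) (- derive1 f (- x)).
    by rewrite -mulrN1; exact: (is_derive_comp (is_deriveNid x 1) (D (- x))).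
  have -> : derive1 f x = - derive1 f (- x); last by rewrite opprK.
  have fE : (fun y => f (- y)) = f by apply/funext => y; exact: ef.
  by rewrite fE in D1; rewrite [LHS]derive1E derive_val.
have d0 : derive1 f 0 = 0 by have := odd 0; rewrite oppr0; lra.
have [h Sh H] := rschwartz_quotient (rschwartz_deriv Sf) d0.
exists (fun x => 2^-1 * (h x + h (- x))); first exact: eschwartz_symmetrize.
move=> x; have := H x; have := H (- x); rewrite odd !subr0 => H1 H2.
by rewrite mulrCA mulrDr -H2 -[h (- x)]opprK mulrN -mulNr mulrN -H1; lra.
Qed.

(** Evenness gives a second zero at [- a], distinct from [a]; division by x - a and then by x + a
    yields the factor. *)
Lemma eschwartz_sqr_quotient f a : 0 < a -> eschwartz f -> f a = 0 ->
  exists2 h, eschwartz h & forall x, f x = (x ^+ 2 - a ^+ 2) * h x.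
Proof.
move=> a0 [Sf ef] fa0; have [h1 Sh1 H1] := rschwartz_quotient Sf fa0.
have h1a : h1 (- a) = 0.
  have := H1 (- a); rewrite ef fa0 => /esym/eqP.
  by rewrite mulf_eq0 => /orP[/eqP|/eqP//]; lra.
have [h Sh H] := rschwartz_quotient Sh1 h1a.
exists (fun x => 2^-1 * (h x + h (- x))); first exact: eschwartz_symmetrize.
have E x : f x = (x ^+ 2 - a ^+ 2) * h x by rewrite H1 H; ring.
by move=> x; have := E (- x); rewrite ef sqrrN => E'; have := E x; lra.
Qed.

End EvenQuotient.

(** * The Bessel series *)

Section BesselSeries.
Context {R : realType}.
Implicit Types (x y z nu : R) (n : nat).

(** The coefficients of x^(-nu) J_nu(x) as a power series in z = x^2. In the variable z,
    differentiation merely shifts the order, up to the factor -1/2. *)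
Definition bessel_coef nu n : R :=
  (-1) ^+ n / (n`!%:R * Gamma (n%:R + nu + 1)) * 2^-1 `^ (2 * n%:R + nu).

Lemma powR_halfS (s : R) : 2^-1 `^ (s + 1) = 2^-1 `^ s * 2^-1.
Proof. by rewrite powR_pD ?invr_gt0// powRr1 ?invr_ge0. Qed.

Lemma Gamma_arg_gt0 nu n : -1 < nu -> 0 < n%:R + nu + 1.
Proof. by move=> nu1; have := ler0n R n; lra. Qed.

(** From n = 1 on the argument exceeds 1, so the functional equation makes the values nondecreasing.
    Only the step from n = 0 may decrease, whence the minimum of the first two values. *)
Lemma Gamma_lbound nu : -1 < nu -> exists2 c, 0 < c & forall n, c <= Gamma (n%:R + nu + 1).
Proof.
move=> nu1; pose c0 := Gamma (nu + 1); pose c1 := Gamma (nu + 1 + 1).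
have p0 : 0 < c0 by apply: Gamma_gt0; lra.
have p1 : 0 < c1 by apply: Gamma_gt0; lra.
have H n : c1 <= Gamma (n.+1%:R + nu + 1).
  elim: n => [|n IH]; first by rewrite /c1 (_ : 1%:R + nu + 1 = nu + 1 + 1)//; ring.
  rewrite (_ : n.+2%:R + nu + 1 = (n.+1%:R + nu + 1) + 1); last by rewrite -natr1; ring.
  rewrite GammaS; last exact: Gamma_arg_gt0.
  rewrite (le_trans IH)// ler_peMl ?(le_trans (ltW p1) IH)//.
  by rewrite -natr1; have := ler0n R n; lra.
exists (Num.min c0 c1) => [|[|n]]; first by rewrite lt_min p0.
  by rewrite add0r ge_min lexx.
by rewrite ge_min H orbT.
Qed.

Lemma bessel_coef_bound nu : -1 < nu ->
  exists2 K, 0 <= K & forall n, `|bessel_coef nu n| <= K / n`!%:R.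
Proof.
move=> nu1; have [c c0 Hc] := Gamma_lbound nu1.
(* The 2 bounds (1/2)^(2n+nu), the exponent being at least -1. *)
exists (2 / c) => [|n]; first by rewrite divr_ge0// ltW.
have f0 : 0 < n`!%:R :> R by rewrite ltr0n fact_gt0.
have h0 : 0 <= 2^-1 :> R by [].
rewrite /bessel_coef !normrM normrX normrN1 expr1n mul1r normfV normrM.
rewrite (gtr0_norm f0) (ger0_norm (powR_ge0 _ _)) (ger0_norm (le_trans (ltW c0) (Hc n))).
have -> : 2 / c / n`!%:R = (n`!%:R * c)^-1 * 2 by rewrite invfM; ring.
have G0 := lt_le_trans c0 (Hc n).
apply: ler_pM; rewrite ?powR_ge0// ?invr_ge0 ?mulr_ge0 ?(ltW G0) ?(ltW f0)//.
  by rewrite lef_pV2 ?posrE ?(mulr_gt0 f0)// ler_pM2l.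
have e2 : 2 = 2^-1 `^ (-1) :> R by rewrite powR_inv1// invrK.
have h01 : 0 < (2^-1 : R) <= 1 by rewrite invr_gt0 ltr0n invf_le1 ?ler1n ?ltr0n.
have e1 : -1 <= 2 * n%:R + nu by have := ler0n R n; lra.
by rewrite [leRHS]e2; exact: (ger_powR h01 e1).
Qed.

Lemma is_cvg_bessel_series nu z : -1 < nu -> cvgn (pseries (bessel_coef nu) z).
Proof.
move=> nu1; have [K K0 HK] := bessel_coef_bound nu1.
apply: normed_cvg; apply: (@series_le_cvg _ _ (fun n => K * exp_coeff `|z| n)).
- by move=> n /=.
- by move=> n; rewrite mulr_ge0// exp_coeff_ge0.
- move=> n /=; rewrite normrM normrX /exp_coeff /=.
  rewrite (le_trans (ler_wpM2r _ (HK n))) ?exprn_ge0//.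
  by rewrite -mulrA [X in K * X]mulrC.
- exact: (is_cvg_seriesZ (is_cvg_series_exp_coeff _)).
Qed.

Definition bessel_fun nu z : R := limn (pseries (bessel_coef nu) z).

Lemma bessel_series_cvg nu z : -1 < nu ->
  pseries (bessel_coef nu) z @ \oo --> bessel_fun nu z.
Proof. exact: is_cvg_bessel_series. Qed.

Lemma bessel_coef_rec nu n : -1 < nu ->
  bessel_coef nu n = 2 * (n%:R + nu + 1) * bessel_coef (nu + 1) n.
Proof.
move=> nu1; rewrite /bessel_coef.
have g0 := Gamma_arg_gt0 n nu1; have G0 := Gamma_gt0 g0.
rewrite (_ : n%:R + (nu + 1) + 1 = (n%:R + nu + 1) + 1); last ring.
rewrite (GammaS g0) (_ : 2 * n%:R + (nu + 1) = (2 * n%:R + nu) + 1); last ring.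
rewrite (powR_halfS (2 * n%:R + nu)).
field; rewrite !lt0r_neq0//= ?ltr0n ?fact_gt0//.
Qed.

Lemma bessel_coef_diffs nu n :
  pseries_diffs (bessel_coef nu) n = - 2^-1 * bessel_coef (nu + 1) n.
Proof.
rewrite /pseries_diffs /bessel_coef.
rewrite (_ : n.+1%:R + nu + 1 = n%:R + (nu + 1) + 1); last by rewrite -natr1; ring.
rewrite (_ : 2 * n.+1%:R + nu = (2 * n%:R + (nu + 1)) + 1); last by rewrite -natr1; ring.
rewrite (powR_halfS (2 * n%:R + (nu + 1))).
rewrite factS natrM exprS !invfM mulN1r.
have n0 : n.+1%:R != 0 :> R by rewrite pnatr_eq0.
set A := (Gamma _)^-1; set B := (n`!%:R)^-1; set C := _ `^ _.
by field.
Qed.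

Lemma pseries_bessel_diffs nu z :
  pseries (pseries_diffs (bessel_coef nu)) z =
  (fun n => - 2^-1 * pseries (bessel_coef (nu + 1)) z n).
Proof.
apply/funext => n; rewrite /pseries /series/= mulr_sumr; apply: eq_bigr => i _.
by rewrite bessel_coef_diffs -[LHS]mulrA.
Qed.

Lemma cvg_pseries_bessel_diffs nu z : -1 < nu ->
  pseries (pseries_diffs (bessel_coef nu)) z @ \oo --> - 2^-1 * bessel_fun (nu + 1) z.
Proof.
move=> nu1; rewrite pseries_bessel_diffs; apply: cvgM; first exact: cvg_cst.
by apply: bessel_series_cvg; lra.
Qed.

(** Termwise differentiation, which asks for convergence of the series and of its first two derived
    series at a point of modulus greater than |z|; |z| + 1 is taken. The derived series are
    multiples of Bessel series of higher order, so they converge everywhere. *)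
Lemma is_derive_bessel_fun nu z : -1 < nu ->
  is_derive z 1 (bessel_fun nu) (- 2^-1 * bessel_fun (nu + 1) z).
Proof.
move=> nu1; rewrite -(cvg_lim _ (cvg_pseries_bessel_diffs (z := z) nu1))//.
have nu2 : -1 < nu + 1 by lra.
apply: (@pseries_snd_diffs _ _ (`|z| + 1)).
- exact: is_cvg_bessel_series.
- by apply/cvg_ex; eexists; exact: cvg_pseries_bessel_diffs.
- have -> : pseries_diffs (pseries_diffs (bessel_coef nu)) =
      (fun n => - 2^-1 * pseries_diffs (bessel_coef (nu + 1)) n).
    by apply/funext => n; rewrite {1}/pseries_diffs bessel_coef_diffs /pseries_diffs mulrCA.
  have -> : pseries (fun n => - 2^-1 * pseries_diffs (bessel_coef (nu + 1)) n) (`|z| + 1) =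
      (fun n => - 2^-1 * pseries (pseries_diffs (bessel_coef (nu + 1))) (`|z| + 1) n).
    apply/funext => n; rewrite /pseries /series/= mulr_sumr; apply: eq_bigr => i _.
    by rewrite -[LHS]mulrA.
  apply/cvg_ex; eexists; apply: cvgM; first exact: cvg_cst.
  exact: cvg_pseries_bessel_diffs.
- by rewrite [ltRHS]ger0_norm ?addr_ge0// ltrDl.
Qed.

(** In the coefficient identity the factor 2(n + nu + 1) splits as (2 nu + 2) + 2n. The part with 2n
    is 2z times the derivative of the series of order nu + 1, which brings in order nu + 2. *)
Lemma bessel_fun_rec nu z : -1 < nu ->
  bessel_fun nu z = (2 * nu + 2) * bessel_fun (nu + 1) z - z * bessel_fun (nu + 1 + 1) z.
Proof.
move=> nu1; have nu2 : -1 < nu + 1 by lra.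
(* The derived series has one term fewer, because the term of index 0 is killed by its factor. *)
have E n : pseries (bessel_coef nu) z n.+1 =
    (2 * nu + 2) * pseries (bessel_coef (nu + 1)) z n.+1
    + 2 * z * pseries (pseries_diffs (bessel_coef (nu + 1))) z n.
  transitivity (\sum_(0 <= i < n.+1) ((2 * nu + 2) * (bessel_coef (nu + 1) i * z ^+ i)
      + 2 * (i%:R * bessel_coef (nu + 1) i * z ^+ i))).
    by apply: eq_bigr => i _ /=; rewrite [in LHS]bessel_coef_rec//; ring.
  rewrite big_split/= -!mulr_sumr; congr (_ + _).
  rewrite big_nat_recl// mul0r mul0r add0r -mulrA; congr (_ * _).
  rewrite /pseries /series/= mulr_sumr; apply: eq_bigr => i _.
  by rewrite /pseries_diffs exprS; ring.
have : (fun n => pseries (bessel_coef nu) z n.+1) @ \oo -->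
    (2 * nu + 2) * bessel_fun (nu + 1) z + 2 * z * (- 2^-1 * bessel_fun (nu + 1 + 1) z).
  under eq_cvg do rewrite E.
  apply: cvgD; apply: cvgM; try exact: cvg_cst.
    by rewrite (cvg_shiftS (pseries (bessel_coef (nu + 1)) z)); exact: bessel_series_cvg.
  exact: cvg_pseries_bessel_diffs.
rewrite (cvg_shiftS (pseries (bessel_coef nu) z)) => /cvg_lim; rewrite -/(bessel_fun _ _) => -> //.
by field.
Qed.

(* [Phi nu x] extends [x ^ (- nu) J_nu x] to an entire even function. *)
Definition Phi nu x : R := bessel_fun nu (x ^+ 2).

Lemma PhiN nu x : Phi nu (- x) = Phi nu x.
Proof. by rewrite /Phi sqrrN. Qed.

Lemma is_derive_Phi nu x : -1 < nu ->
  is_derive x 1 (Phi nu) (- x * Phi (nu + 1) x).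
Proof.
move=> nu1.
have D := is_derive_mul (is_derive_id x 1) (is_derive_id x 1).
apply: (is_derive_ext (is_derive_comp D (is_derive_bessel_fun _ nu1))) => [y|].
  by rewrite /Phi expr2.
by rewrite /Phi expr2 /=; field.
Qed.

Lemma Phi_rec nu x : -1 < nu ->
  Phi nu x = (2 * nu + 2) * Phi (nu + 1) x - x ^+ 2 * Phi (nu + 1 + 1) x.
Proof. exact: bessel_fun_rec. Qed.

Lemma Phi0 nu : -1 < nu -> Phi nu 0 = 2 `^ (- nu) / Gamma (nu + 1).
Proof.
move=> nu1; rewrite /Phi expr0n /= /bessel_fun.
apply/cvg_lim => //; rewrite -cvg_shiftS; apply: cvg_near_cst; near=> n.
rewrite /pseries /series/= big_nat_recl// big1 ?addr0 => [|i _]; last first.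
  by rewrite expr0n mulr0.
rewrite /bessel_coef expr0 fact0 mul1r mulr1 !mulr0 !add0r mul1r.
by rewrite mulrC -(powR_inv1 (ler0n _ 2)) -powRrM mulN1r.
Unshelve. all: by end_near. Qed.

Lemma bessel_phiE nu x : -1 < nu -> 0 < x -> bessel_phi nu x = Phi nu x.
Proof.
move=> nu1 x0; rewrite /bessel_phi /besselJ.
have -> : series (fun n => (-1) ^+ n / (n`!%:R * Gamma (n%:R + nu + 1)) *
    (x / 2) `^ (2 * n%:R + nu)) = (fun n => x `^ nu * pseries (bessel_coef nu) (x ^+ 2) n).
  apply/funext => n; rewrite /pseries /series/= mulr_sumr; apply: eq_bigr => i _.
  have e : x `^ (2 * i%:R + nu) = x `^ nu * (x ^+ 2) ^+ i.
    by rewrite powR_pD// mulrC powRrM (powR_mulrn 2 (ltW x0)) powR_mulrn ?exprn_ge0 ?ltW.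
  by rewrite powRM ?invr_ge0 ?(ltW x0)// e /bessel_coef; ring.
rewrite (cvg_lim _ (cvgM (@cvg_cst _ (x `^ nu) _ _ _) (bessel_series_cvg (z := x ^+ 2) nu1)))//.
by rewrite mulrA -powR_pD// addrC subrr powRr0 mul1r.
Qed.

(* The energy [Phi ^ 2 + Phi'^ 2] decreases along the Bessel equation. *)
Lemma Phi_bounded nu : - 2^-1 <= nu -> exists C, forall x, `|Phi nu x| <= C.
Proof.
move=> nuh; have nu1 : -1 < nu by lra.
have nu2 : -1 < nu + 1 by lra.
pose P0 := Phi nu; pose P1 := Phi (nu + 1); pose P2 := Phi (nu + 1 + 1).
pose E x := P0 x * P0 x + (x * P1 x) * (x * P1 x).
(* The terms with [P2] cancel by the recurrence. The sign of 2 nu + 1 is where the lower bound on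
   the order enters. *)
have DE x : is_derive x 1 E (- 2 * (2 * nu + 1) * x * P1 x ^+ 2).
  have D0 := is_derive_Phi x nu1; have D1 := is_derive_Phi x nu2.
  have Dx := is_derive_mul (is_derive_id x 1) D1.
  apply: (is_derive_eq (is_derive_add (is_derive_mul D0 D0) (is_derive_mul Dx Dx))).
  have := Phi_rec x nu1; rewrite -/(P0 x) -/(P1 x) -/(P2 x) => ->.
  by rewrite /=; ring.
have E0 x : 0 <= x -> E x <= E 0.
  move=> x0; apply: (@ler0_derive1_nincry _ E 0) => //.
  - move=> y; rewrite in_itv/= andbT => y0; rewrite (is_derive_funE DE).
    have : 0 <= (2 * nu + 1) * (y * P1 y ^+ 2).
      by apply: mulr_ge0; [lra|apply: mulr_ge0; [exact: ltW|exact: sqr_ge0]].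
    by lra.
  - by apply: continuous_subspaceT => y; exact: is_derive_continuous (DE y).
exists (`|P0 0|) => x; wlog x0 : x / 0 <= x.
  move=> H; have [/H//|x0] := leP 0 x.
  by rewrite -PhiN; apply: H; lra.
rewrite -ler_sqr ?nnegrE// !real_normK ?num_real//.
have := E0 _ x0; rewrite /E !mul0r addr0 -!expr2 => H.
by apply: le_trans H; rewrite lerDl sqr_ge0.
Qed.

(** The recurrence writes the kernel through those of orders nu + 1 and nu + 2, which are bounded.
    Polynomial growth suffices for integrability against Schwartz functions. *)
Lemma Phi_bound nu : -1 < nu -> exists C, forall x, `|Phi nu x| <= C * (1 + x ^+ 2).
Proof.
move=> nu1.
have [C1 H1] : exists C, forall x, `|Phi (nu + 1) x| <= C by apply: Phi_bounded; lra.
have [C2 H2] : exists C, forall x, `|Phi (nu + 1 + 1) x| <= C by apply: Phi_bounded; lra.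
exists ((2 * nu + 2) * C1 + C2) => x; rewrite Phi_rec//.
have n0 : 0 <= 2 * nu + 2 by lra.
have x2 := sqr_ge0 x.
have C10 := le_trans (normr_ge0 _) (H1 x); have C20 := le_trans (normr_ge0 _) (H2 x).
rewrite (le_trans (ler_normB _ _))// (normrM (2 * nu + 2)) (normrM (x ^+ 2)) (ger0_norm n0) (ger0_norm x2).
have a1 := ler_wpM2l n0 (H1 x); have a2 := ler_wpM2l x2 (H2 x).
have := mulr_ge0 (mulr_ge0 n0 C10) x2.
lra.
Qed.

End BesselSeries.

(** * The real transform *)

Section RealTransform.
Context {R : realType}.
Local Notation mu := (@lebesgue_measure R).
Local Notation half := (`]0, +oo[%classic : set R).
Implicit Types (f g h : R -> R) (x y p nu : R).

(** With [Phi] in place of [bessel_phi] the integrand makes sense for every real [y], so this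
    function is itself the even extension of the transform. *)
Definition FB nu f y : R :=
  \int[mu]_(x in half) (Phi nu (x * y) * f x * x `^ (2 * nu + 1)).

Lemma measurable_half_schwartz f : rschwartz f -> measurable_fun half f.
Proof. by move=> Sf; apply: measurable_half_continuous => x _; exact: rschwartz_continuous. Qed.

Lemma half_rapid_norm_schwartz f : rschwartz f -> half_rapid (fun x => `|f x|).
Proof.
move=> /rschwartz_rapid/rapid_half_rapid rf k; have [C H] := rf k.
by exists C => x x0; rewrite normr_id H.
Qed.

Lemma is_derive_Phi_mulr nu y x : -1 < nu ->
  is_derive x 1 (fun x => Phi nu (x * y)) (- (x * y ^+ 2) * Phi (nu + 1) (x * y)).
Proof.
move=> nu1; have D := is_derive_mul (is_derive_id x 1) (is_derive_cst y x 1).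
apply: (is_derive_ext (is_derive_comp D (is_derive_Phi _ nu1))) => //=.
by rewrite /cst; ring.
Qed.

Lemma half_rapid_Phi nu y f : -1 < nu -> half_rapid f ->
  half_rapid (fun x => Phi nu (x * y) * f x).
Proof.
move=> nu1 rf; have [C H] := Phi_bound nu1.
apply: (half_rapid_mul (A := C * (1 + y ^+ 2)) (m := 2) rf) => x x0.
have C0 : 0 <= C by have := le_trans (normr_ge0 _) (H 0); rewrite expr0n addr0 mulr1.
rewrite (le_trans (H _))// -mulrA ler_wpM2l// exprMn.
have := sqr_ge0 x; have := sqr_ge0 y; nra.
Qed.

Lemma measurable_Phi_mulr nu y : -1 < nu -> measurable_fun half (fun x => Phi nu (x * y)).
Proof.
move=> nu1; apply: measurable_half_continuous => x _.
exact: is_derive_continuous (is_derive_Phi_mulr y x nu1).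
Qed.

Lemma FB_kernel_integrable nu p y f : -1 < nu -> -1 < p -> rschwartz f ->
  mu.-integrable half (EFin \o (fun x => Phi nu (x * y) * f x * x `^ p)).
Proof.
move=> nu1 p1 Sf; apply: half_rapid_integrable => //.
- by apply: half_rapid_Phi => //; exact/rapid_half_rapid/rschwartz_rapid.
- apply: measurable_funM; first exact: measurable_Phi_mulr.
  exact: measurable_half_schwartz.
Qed.

Lemma FB_integrable nu y f : -1 < nu -> rschwartz f ->
  mu.-integrable half (EFin \o (fun x => Phi nu (x * y) * f x * x `^ (2 * nu + 1))).
Proof. by move=> nu1; apply: FB_kernel_integrable => //; lra. Qed.

Lemma FB_add nu f g y : -1 < nu -> rschwartz f -> rschwartz g ->
  FB nu (fun x => f x + g x) y = FB nu f y + FB nu g y.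
Proof.
move=> nu1 Sf Sg; rewrite /FB -RintegralD//; try exact: FB_integrable.
by apply: eq_Rintegral => x _; rewrite mulrDr mulrDl.
Qed.

Lemma FB_scale nu c f y : -1 < nu -> rschwartz f ->
  FB nu (fun x => c * f x) y = c * FB nu f y.
Proof.
move=> nu1 Sf; rewrite /FB -RintegralZl//; last exact: FB_integrable.
by apply: eq_Rintegral => x _; ring.
Qed.

Lemma FB_even nu f : even_fun (FB nu f).
Proof. by move=> y; apply: eq_Rintegral => x _; rewrite mulrN PhiN. Qed.

(** Differentiating the kernel in y produces -x^2 y times the kernel of order nu + 1, and x^2 turns
    the weight of order nu into that of order nu + 1. For |z - y| < 1 the derivative is dominated
    because the kernel of order nu + 1 is bounded. *)
Lemma is_derive_FB nu f y : -1 < nu -> rschwartz f ->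
  is_derive y 1 (FB nu f) (- y * FB (nu + 1) f y).
Proof.
move=> nu1 Sf; have nu2 : -1 < nu + 1 by lra.
have [C HC] : exists C, forall x, `|Phi (nu + 1) x| <= C by apply: Phi_bounded; lra.
have C0 := le_trans (normr_ge0 _) (HC 0).
pose df z x := - (x ^+ 2 * z) * Phi (nu + 1) (x * z) * f x * x `^ (2 * nu + 1).
have pE x : 0 < x -> x `^ (2 * (nu + 1) + 1) = x ^+ 2 * x `^ (2 * nu + 1).
  move=> x0; rewrite -(powR_mulrn 2 (ltW x0)) -powR_pD//; congr (_ `^ _); ring.
have -> : - y * FB (nu + 1) f y = \int[mu]_(x in half) df y x.
  rewrite /FB -RintegralZl//; last exact: FB_integrable.
  by apply: eq_Rintegral => x /set_mem/halfE x0; rewrite pE// /df; ring.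
pose g x := (`|y| + 1) * C * (`|f x| * x `^ (2 * (nu + 1) + 1)).
apply: (@is_derive_under_integral _
  (fun z x => Phi nu (x * z) * f x * x `^ (2 * nu + 1)) df half g y 1) => //.
- by move=> z _; exact: FB_integrable.
- move=> z x _ _.
  have Dx := is_derive_scale x (is_derive_id z 1).
  have D := is_derive_comp Dx (is_derive_Phi _ nu1).
  apply: (is_derive_ext (is_derive_scale (f x * x `^ (2 * nu + 1)) D)) => [t|] /=; first by ring.
  by rewrite /df; ring.
- apply: integrable_scale => //; apply: half_rapid_integrable; first lra.
  + exact: half_rapid_norm_schwartz.
  + apply: measurableT_comp => //; exact: measurable_half_schwartz.
- move=> z x zy /halfE x0; rewrite /df /g pE//.
  have zC : `|z| <= `|y| + 1.
    rewrite -[X in `|X| <= _](subrK y) (le_trans (ler_normD _ _))// addrC lerD2l; exact: ltW.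
  rewrite !normrM normrN (normrM (x ^+ 2)) (ger0_norm (powR_ge0 _ _)) (ger0_norm (sqr_ge0 x)).
  have -> : x ^+ 2 * `|z| * `|Phi (nu + 1) (x * z)| * `|f x| * x `^ (2 * nu + 1) =
    `|z| * `|Phi (nu + 1) (x * z)| * (`|f x| * (x ^+ 2 * x `^ (2 * nu + 1))) by ring.
  apply: ler_wpM2r; first by apply: mulr_ge0 => //; apply: mulr_ge0; rewrite ?sqr_ge0 ?powR_ge0.
  by apply: ler_pM.
Qed.

(** * Integration by parts and identities shifting the order *)

Lemma Rintegral_primitive_eq0 nu p y f (G : R -> R) : -1 < nu -> 0 < p -> rschwartz f ->
  (forall x, 0 < x ->
    is_derive x 1 (fun x => Phi nu (x * y) * f x * x `^ p) (G x)) ->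
  (forall x, 0 < x -> {for x, continuous G}) -> mu.-integrable half (EFin \o G) ->
  \int[mu]_(x in half) G x = 0.
Proof.
move=> nu1 p0 Sf DG cG iG.
have rPf : half_rapid (fun x => Phi nu (x * y) * f x).
  by apply: half_rapid_Phi => //; exact/rapid_half_rapid/rschwartz_rapid.
rewrite (half_FTC DG cG iG (l0 := 0) (l1 := 0)) ?subr0//; last exact: half_rapid_cvgy.
have [C H] := rPf 0%N; apply: (powR_bounded_cvg0 (C := C)) => // x /andP[x0 _].
by have := H _ x0; rewrite expr0 mul1r.
Qed.

Lemma is_derive_FB_primitive nu p y f x : -1 < nu -> rschwartz f -> 0 < x ->
  is_derive x 1 (fun x => Phi nu (x * y) * f x * x `^ (p + 1))
    (- y ^+ 2 * (Phi (nu + 1) (x * y) * (x * (x * f x)) * x `^ p)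
     + (p + 1) * (Phi nu (x * y) * f x * x `^ p)
     + Phi nu (x * y) * (x * derive1 f x) * x `^ p).
Proof.
move=> nu1 Sf x0.
apply: (is_derive_eq (is_derive_mul (is_derive_mul (is_derive_Phi_mulr y x nu1)
  (rschwartz_is_derive Sf x)) (is_derive1_powR (p + 1) x0))).
by rewrite addrK powR_pD// (powRr1 (ltW x0)); ring.
Qed.

(** The three terms come from differentiating the kernel, the power x^(p+1) and [f]. The exponent
    [p] is kept independent of the order since 2 nu + 1 is used twice: with order nu in [FB_Euler],
    and with order nu + 1 in [FB_deriv_quotient]. *)
Lemma FB_parts nu p y f : -1 < nu -> -1 < p -> rschwartz f ->
  - y ^+ 2 * (\int[mu]_(x in half) (Phi (nu + 1) (x * y) * (x * (x * f x)) * x `^ p))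
  + (p + 1) * (\int[mu]_(x in half) (Phi nu (x * y) * f x * x `^ p))
  + \int[mu]_(x in half) (Phi nu (x * y) * (x * derive1 f x) * x `^ p) = 0.
Proof.
move=> nu1 p1 Sf; have nu2 : -1 < nu + 1 by lra.
have Sxxf := rschwartz_mulx (rschwartz_mulx Sf).
have Sxdf := rschwartz_mulx (rschwartz_deriv Sf).
have i1 := FB_kernel_integrable y nu2 p1 Sxxf.
have i2 := FB_kernel_integrable y nu1 p1 Sf.
have i3 := FB_kernel_integrable y nu1 p1 Sxdf.
have mh : measurable half by exact: measurable_itv.
have i1' := integrable_scale (- y ^+ 2) mh i1.
have i2' := integrable_scale (p + 1) mh i2.
have i12 := integrable_add mh i1' i2'.
rewrite -!RintegralZl// -RintegralD// -RintegralD//.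
apply: (@Rintegral_primitive_eq0 nu (p + 1) y f) => //; first lra.
- by move=> x x0; exact: is_derive_FB_primitive.
- move=> x x0; have DW := is_derive1_powR p x0.
  have D1 := is_derive_Phi_mulr y x nu1; have D2 := is_derive_Phi_mulr y x nu2.
  have Df g : rschwartz g -> is_derive x 1 g (derive1 g x) by move=> /rschwartz_is_derive.
  have C1 := is_derive_scale (- y ^+ 2) (is_derive_mul (is_derive_mul D2 (Df _ Sxxf)) DW).
  have C2 := is_derive_scale (p + 1) (is_derive_mul (is_derive_mul D1 (Df _ Sf)) DW).
  have C3 := is_derive_mul (is_derive_mul D1 (Df _ Sxdf)) DW.
  exact: is_derive_continuous (is_derive_add (is_derive_add C1 C2) C3).
- exact: integrable_add.
Qed.

Lemma powR_add2 p x : 0 < x -> x `^ (p + 2) = x * (x * x `^ p).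
Proof.
move=> x0; rewrite powR_pD// (powR_mulrn 2 (ltW x0)) expr2; ring.
Qed.

Lemma FB_Euler nu f y : -1 < nu -> rschwartz f ->
  FB nu (fun x => x * derive1 f x + (2 * nu + 2) * f x) y = y ^+ 2 * FB (nu + 1) f y.
Proof.
move=> nu1 Sf; have p1 : -1 < 2 * nu + 1 by lra.
have := FB_parts y nu1 p1 Sf.
have -> : \int[mu]_(x in half) (Phi (nu + 1) (x * y) * (x * (x * f x)) * x `^ (2 * nu + 1)) =
    FB (nu + 1) f y.
  apply: eq_Rintegral => x /set_mem/halfE x0.
  rewrite (_ : 2 * (nu + 1) + 1 = 2 * nu + 1 + 2); last ring.
  by rewrite powR_add2//; ring.
rewrite FB_add ?FB_scale//; last 2 first.
- exact/rschwartz_mulx/rschwartz_deriv.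
- exact: rschwartz_scale.
rewrite -/(FB nu f y) -/(FB nu (fun x => x * derive1 f x) y) (_ : 2 * nu + 1 + 1 = 2 * nu + 2); last ring.
by move: (FB _ _ _) (FB _ _ _) (FB _ _ _) => a b c; lra.
Qed.

(** Parts are taken at order nu + 1 but with the weight of order nu: the two terms containing [f]
    then recombine by [Phi_rec] into the kernel of order nu. *)
Lemma FB_deriv_quotient nu f h y : -1 < nu -> rschwartz f -> rschwartz h ->
  (forall x, derive1 f x = x * h x) -> FB nu f y = - FB (nu + 1) h y.
Proof.
move=> nu1 Sf Sh fh; have p1 : -1 < 2 * nu + 1 by lra.
have nu2 : -1 < nu + 1 by lra. have nu3 : -1 < nu + 1 + 1 by lra.
have := FB_parts y nu2 p1 Sf.
have -> : \int[mu]_(x in half) (Phi (nu + 1) (x * y) * (x * derive1 f x) * x `^ (2 * nu + 1)) =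
    FB (nu + 1) h y.
  apply: eq_Rintegral => x /set_mem/halfE x0; rewrite fh.
  rewrite (_ : 2 * (nu + 1) + 1 = 2 * nu + 1 + 2); last ring.
  by rewrite powR_add2//; ring.
move=> /eqP; rewrite addr_eq0 => /eqP <-.
have Sxxf := rschwartz_mulx (rschwartz_mulx Sf).
rewrite -!RintegralZl//; try exact: FB_kernel_integrable.
rewrite -RintegralD//; try by apply: integrable_scale => //; exact: FB_kernel_integrable.
apply: eq_Rintegral => x _; rewrite Phi_rec//; ring.
Qed.

Lemma FB_sqr nu f y : -1 < nu -> rschwartz f ->
  FB nu (fun x => x * (x * f x)) y =
  (2 * nu + 2) * FB (nu + 1) f y - y ^+ 2 * FB (nu + 1 + 1) f y.
Proof.
move=> nu1 Sf; have nu2 : -1 < nu + 1 by lra. have nu3 : -1 < nu + 1 + 1 by lra.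
rewrite -mulNr /FB -!RintegralZl//; try exact: FB_integrable.
rewrite -RintegralD//; try by apply: integrable_scale => //; exact: FB_integrable.
apply: eq_Rintegral => x /set_mem/halfE x0.
rewrite (_ : 2 * (nu + 1 + 1) + 1 = (2 * nu + 1 + 2) + 2); last ring.
rewrite (_ : 2 * (nu + 1) + 1 = 2 * nu + 1 + 2); last ring.
by rewrite !powR_add2// Phi_rec//; ring.
Qed.

(** * Stability of even Schwartz functions under the transform *)

Lemma eschwartz_sqr f : eschwartz f -> eschwartz (fun x => x * (x * f x)).
Proof.
move=> [Sf ef]; split; first exact/rschwartz_mulx/rschwartz_mulx.
by move=> x; rewrite ef; ring.
Qed.

Lemma eschwartz_add f g : eschwartz f -> eschwartz g -> eschwartz (fun x => f x + g x).
Proof. by move=> [Sf ef] [Sg eg]; split=> [|x]; [exact: rschwartz_add|rewrite ef eg]. Qed.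

Lemma eschwartz_scale c f : eschwartz f -> eschwartz (fun x => c * f x).
Proof. by move=> [Sf ef]; split=> [|x]; [exact: rschwartz_scale|rewrite ef]. Qed.

Lemma eschwartz_Euler c f : eschwartz f ->
  eschwartz (fun x => x * derive1 f x + c * f x).
Proof.
move=> Ef; have [h Eh H] := eschwartz_deriv_quotient Ef.
have -> : (fun x => x * derive1 f x + c * f x) = (fun x => x * (x * h x) + c * f x).
  by apply/funext => x; rewrite H.
by apply: eschwartz_add; [exact: eschwartz_sqr|exact: eschwartz_scale].
Qed.

(** The kernel of order nu + 1 is bounded whatever the order nu > -1, so the estimate is made on the
    transform of [h] at that order. *)
Lemma FB_bounded nu f : -1 < nu -> eschwartz f -> exists C, forall y, `|FB nu f y| <= C.
Proof.
move=> nu1 Ef; have [h [Sh _] H] := eschwartz_deriv_quotient Ef.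
have nu2 : -1 < nu + 1 by lra.
have [C HC] : exists C, forall x, `|Phi (nu + 1) x| <= C by apply: Phi_bounded; lra.
exists (\int[mu]_(x in half) (C * (`|h x| * x `^ (2 * (nu + 1) + 1)))) => y.
rewrite (FB_deriv_quotient y nu1 Ef.1 Sh H) normrN.
have iFB := FB_integrable y nu2 Sh.
rewrite (le_trans (le_normr_Rintegral _ iFB))//.
apply: (@le_Rintegral _ _ _ mu half) => //.
- exact: integrable_norm.
- apply: integrable_scale => //; apply: half_rapid_integrable; first lra.
  + exact: half_rapid_norm_schwartz.
  + apply: measurableT_comp => //; exact: measurable_half_schwartz.
- move=> x /halfE x0; rewrite !normrM (ger0_norm (powR_ge0 _ _)) -mulrA.
  by rewrite ler_wpM2r// mulr_ge0 ?powR_ge0.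
Qed.

(** Passing from [f] to [h] raises the order by one, and [FB_Euler] lowers it again while absorbing
    y^2. Hence y^2 F_nu f is up to sign a transform of the same order nu, and the induction runs on
    [m] with [f] arbitrary. *)
Lemma FB_sqr_bounded nu f (m : nat) : -1 < nu -> eschwartz f ->
  exists C, forall y, (y ^+ 2) ^+ m * `|FB nu f y| <= C.
Proof.
move=> nu1; elim: m f => [|m IH] f Ef.
  by have [C H] := FB_bounded nu1 Ef; exists C => y; rewrite expr0 mul1r.
have [h Eh H] := eschwartz_deriv_quotient Ef.
have [C HC] := IH _ (eschwartz_Euler (2 * nu + 2) Eh).
exists C => y; apply: le_trans (HC y).
rewrite (FB_deriv_quotient y nu1 Ef.1 Eh.1 H) normrN FB_Euler//; last exact: Eh.1.
by rewrite (normrM (y ^+ 2)) (ger0_norm (sqr_ge0 y)) (exprSr (y ^+ 2)) -mulrA.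
Qed.

Lemma FB_rapid nu f : -1 < nu -> eschwartz f -> rapid (FB nu f).
Proof.
move=> nu1 Ef k; have [C0 H0] := FB_bounded nu1 Ef.
have [C1 H1] := FB_sqr_bounded k nu1 Ef; exists (C0 + C1) => y.
by rewrite (le_trans (ler_wpM2r _ (exprn_norm_le1Dsqr y k)))// mulrDl mul1r lerD.
Qed.

(** Each derivative raises the order, so the generators are the transforms of [f] of all orders m >
    -1. *)
Lemma FB_schwartz nu f : -1 < nu -> eschwartz f -> eschwartz (FB nu f).
Proof.
move=> nu1 Ef; split; last exact: FB_even.
apply: (@polyspan_schwartz _ (fun q => exists2 m, -1 < m & q = FB m f)) => [_ [m m1 ->]|_ [m m1 ->]|].
- exists (fun y => -1 * (y * FB (m + 1) f y)).
    by apply/polyspan_scale/polyspan_mulx/polyspan_base; exists (m + 1) => //; lra.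
  by move=> y; apply: (is_derive_eq (is_derive_FB y m1 Ef.1)); ring.
- exact: FB_rapid.
- by apply: polyspan_base; exists nu.
Qed.

(** * Inversion *)

(** F_nu (F_nu f) = F_(nu+1) (D (F_nu f)), and D (F_nu f) = F_(nu+1) f. *)
Lemma FB2_shift nu f y : -1 < nu -> eschwartz f ->
  FB (nu + 1) (FB (nu + 1) f) y = FB nu (FB nu f) y.
Proof.
move=> nu1 Ef; have nu2 : -1 < nu + 1 by lra.
have SF := (FB_schwartz nu1 Ef).1; have SF1 := (FB_schwartz nu2 Ef).1.
rewrite (@FB_deriv_quotient nu _ (fun x => -1 * FB (nu + 1) f x))//.
- by rewrite FB_scale// mulN1r opprK.
- exact: rschwartz_scale.
- move=> x; rewrite (is_derive_funE (fun z => is_derive_FB z nu1 Ef.1)); ring.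
Qed.

(** Put G = F_(nu+1) f. Since G' = - y F_(nu+2) f, the kernel recurrence says that F_nu (x^2 f) = y
    G' + (2 nu + 2) G. By [FB_Euler] a second transform gives y^2 F_(nu+1) G, and [FB2_shift] brings
    the order back to nu. *)
Lemma FB2_sqr nu f y : -1 < nu -> eschwartz f ->
  FB nu (FB nu (fun x => x * (x * f x))) y = y ^+ 2 * FB nu (FB nu f) y.
Proof.
move=> nu1 Ef; have nu2 : -1 < nu + 1 by lra.
have SF1 := (FB_schwartz nu2 Ef).1.
have DG := is_derive_funE (fun z => is_derive_FB z nu2 Ef.1).
have -> : FB nu (fun x => x * (x * f x)) =
    (fun x => x * derive1 (FB (nu + 1) f) x + (2 * nu + 2) * FB (nu + 1) f x).
  apply/funext => x; rewrite (FB_sqr _ nu1 Ef.1) DG.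
  by move: (FB _ _ _) (FB _ _ _) => a b; ring.
by rewrite (FB_Euler y nu1 SF1) (FB2_shift y nu1 Ef).
Qed.

(** As D fixes the Gaussian, its transforms of orders nu and nu + 1 agree. The transform then
    satisfies G' = - y G, as the Gaussian does, so their quotient is constant; at 0 it equals 1,
    since [Phi0] and [Rintegral_gauss] give reciprocal values. *)
Lemma FB_gauss nu : -1 < nu -> FB nu gauss = gauss.
Proof.
move=> nu1; have Sg := @rschwartz_gauss R; have nu2 : -1 < nu + 1 by lra.
have shift y : FB nu gauss y = FB (nu + 1) gauss y.
  rewrite (@FB_deriv_quotient nu _ (fun x => -1 * gauss x))//.
  - by rewrite FB_scale// mulN1r opprK.
  - exact: rschwartz_scale.
  - by move=> x; rewrite (is_derive_funE (@is_derive_gauss R)); ring.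
have g0 y : gauss y != 0 :> R by rewrite gt_eqF// gauss_gt0.
have D y : is_derive y 1 (fun y => FB nu gauss y * (gauss y)^-1) 0.
  apply: (is_derive_eq (is_derive_mul (is_derive_FB y nu1 Sg)
    (is_derive_inv (g0 y) (is_derive_gauss y)))).
  by rewrite -shift; field.
apply/funext => y; have := is_derive_0_is_cst (f := fun y => FB nu gauss y * (gauss y)^-1) y 0 D.
have -> : FB nu gauss 0 = 1.
  transitivity (Phi nu 0 * \int[mu]_(x in half) (gauss x * x `^ (2 * nu + 1))).
    rewrite -RintegralZl//.
      by apply: eq_Rintegral => x _; rewrite mulr0 mulrA.
    apply: half_rapid_integrable; first lra.
      exact/rapid_half_rapid/rapid_gauss.
    exact: measurable_half_schwartz.
  have G0 : 0 < Gamma (nu + 1) by apply: Gamma_gt0; lra.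
  rewrite Rintegral_gauss// Phi0// mulrA mulrAC mulfVK ?gt_eqF//.
  by rewrite -powR_pD// addrC subrr powRr0.
rewrite /gauss expr0n/= mul0r oppr0 expR0 invr1 mulr1 -/(gauss y) => H.
by rewrite -[LHS](mulfVK (g0 y)) H mul1r.
Qed.

Lemma FB_involutive nu f x : -1 < nu -> eschwartz f -> 0 < x ->
  FB nu (FB nu f) x = f x.
Proof.
move=> nu1 Ef x0; have Eg : eschwartz (@gauss R) by split; [exact: rschwartz_gauss|exact: gaussN].
(* Subtracting this multiple of the Gaussian makes the function vanish at [x]. The value at the
   single point [x] follows at once, without forming the multiplier function. *)
pose c := f x / gauss x.
have g0 : gauss x != 0 by rewrite gt_eqF// gauss_gt0.
pose f0 t := f t + (- c) * gauss t.
have Ef0 : eschwartz f0 by apply: eschwartz_add => //; exact: eschwartz_scale.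
have f0x : f0 x = 0 by rewrite /f0 /c mulNr divfK// subrr.
have [h Eh H] := eschwartz_sqr_quotient x0 Ef0 f0x.
pose q t := t * (t * h t).
have Eq : eschwartz q by exact: eschwartz_sqr.
(* By linearity the double transform of [f0] at [x] is x^2 times that of [h], minus the same
   quantity. *)
have f0E : f0 = (fun t => q t + (- x ^+ 2) * h t).
  by apply/funext => t; rewrite H /q; ring.
have lin u v (a : R) : eschwartz u -> eschwartz v ->
    FB nu (FB nu (fun t => u t + a * v t)) x = FB nu (FB nu u) x + a * FB nu (FB nu v) x.
  move=> Eu Ev; have [Su _] := Eu; have [Sv _] := Ev.
  have [SFu _] := FB_schwartz nu1 Eu; have [SFv _] := FB_schwartz nu1 Ev.
  have -> : FB nu (fun t => u t + a * v t) = (fun y => FB nu u y + a * FB nu v y).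
    apply/funext => y; rewrite FB_add ?FB_scale//; exact: rschwartz_scale.
  by rewrite FB_add ?FB_scale//; exact: rschwartz_scale.
have : FB nu (FB nu f0) x = 0 by rewrite f0E lin// FB2_sqr//; ring.
rewrite lin// !FB_gauss// => /eqP; rewrite mulNr subr_eq0 => /eqP ->.
by rewrite /c divfK.
Qed.

End RealTransform.

(** * The complex transform *)

Section ComplexTransform.
Context {R : realType}.
Local Notation mu := (@lebesgue_measure R).
Local Notation half := (`]0, +oo[%classic : set R).
Local Notation re f := (fun t => complex.Re (f t)).
Local Notation im f := (fun t => complex.Im (f t)).
Implicit Types (f g : R -> R[i]) (nu x y a b : R).

Lemma normc_ge_abs a b :
  (`|a| <= Normc.normc (a +i* b)%C) * (`|b| <= Normc.normc (a +i* b)%C).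
Proof.
by split; rewrite -sqrtr_sqr ler_wsqrtr// ?lerDl ?lerDr sqr_ge0.
Qed.

Lemma normc_le_add a b : Normc.normc (a +i* b)%C <= `|a| + `|b|.
Proof.
rewrite -[leRHS]ger0_norm ?addr_ge0// -sqrtr_sqr ler_wsqrtr//.
rewrite -(real_normK (num_real a)) -(real_normK (num_real b)).
have := mulr_ge0 (normr_ge0 a) (normr_ge0 b); nra.
Qed.

Lemma schwartzP f : schwartz f <-> rschwartz (re f) /\ rschwartz (im f).
Proof.
split=> [[sf bf]|[[dr rr] [di ri]]]; last first.
  split=> [n x|k n]; first by split; [exact: dr|exact: di].
  have [C1 H1] := rr n k; have [C2 H2] := ri n k; exists (C1 + C2) => x.
  rewrite (le_trans (ler_wpM2l _ (normc_le_add _ _))) ?exprn_ge0//.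
  by rewrite mulrDr lerD.
split; split=> n; first by move=> x; have [] := sf n x.
- move=> k; have [C H] := bf k n; exists C => x; apply: le_trans (H x).
  by rewrite ler_wpM2l ?exprn_ge0// normc_ge_abs.
- by move=> x; have [] := sf n x.
- move=> k; have [C H] := bf k n; exists C => x; apply: le_trans (H x).
  by rewrite ler_wpM2l ?exprn_ge0// normc_ge_abs.
Qed.

Lemma schwartz_halfP f : schwartz_half f <->
  exists u v, [/\ eschwartz u, eschwartz v & forall x, 0 < x -> f x = (u x +i* v x)%C].
Proof.
split=> [[g [/schwartzP[Sr Si] eg fg]]|[u [v [[Su eu] [Sv ev] fuv]]]].
  exists (re g), (im g); split=> [||x /fg ->]; last by case: (g x).
  - by split=> // x; rewrite eg.
  - by split=> // x; rewrite eg.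
exists (fun x => (u x +i* v x)%C); split=> //; first exact/schwartzP.
by move=> x; rewrite eu ev.
Qed.

Lemma fourier_bessel_integrandE nu f y x : -1 < nu -> 0 < y -> 0 < x ->
  fourier_bessel_integrand nu f y x =
  (Phi nu (x * y) * complex.Re (f x) * x `^ (2 * nu + 1) +i*
   (Phi nu (x * y) * complex.Im (f x) * x `^ (2 * nu + 1)))%C.
Proof.
move=> nu1 y0 x0; rewrite /fourier_bessel_integrand bessel_phiE ?mulr_gt0//.
by case: (f x) => a b; apply/eqP; rewrite eq_complex /=; apply/andP; split; apply/eqP; ring.
Qed.

Variables (nu : R) (f : R -> R[i]) (u v : R -> R).
Hypotheses (nu1 : -1 < nu) (Eu : eschwartz u) (Ev : eschwartz v).
Hypothesis fuv : forall x, 0 < x -> f x = (u x +i* v x)%C.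

Lemma fourier_bessel_integrand_re y x : 0 < y -> half x ->
  complex.Re (fourier_bessel_integrand nu f y x) = Phi nu (x * y) * u x * x `^ (2 * nu + 1).
Proof. by move=> y0 /halfE x0; rewrite fourier_bessel_integrandE// fuv. Qed.

Lemma fourier_bessel_integrand_im y x : 0 < y -> half x ->
  complex.Im (fourier_bessel_integrand nu f y x) = Phi nu (x * y) * v x * x `^ (2 * nu + 1).
Proof. by move=> y0 /halfE x0; rewrite fourier_bessel_integrandE// fuv. Qed.

Lemma fourier_bessel_Cintegrable y : 0 < y ->
  Cintegrable half (fourier_bessel_integrand nu f y).
Proof.
have mh : measurable half by exact: measurable_itv.
move=> y0; split.
  apply: (@eq_integrable _ _ _ mu half mh _ _ _ (FB_integrable y nu1 Eu.1)) => x /set_mem hx /=.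
  by rewrite fourier_bessel_integrand_re.
apply: (@eq_integrable _ _ _ mu half mh _ _ _ (FB_integrable y nu1 Ev.1)) => x /set_mem hx /=.
by rewrite fourier_bessel_integrand_im.
Qed.

Lemma fourier_besselE y : 0 < y -> fourier_bessel nu f y = (FB nu u y +i* FB nu v y)%C.
Proof.
move=> y0; congr (_ +i* _)%C; apply: eq_Rintegral => x /set_mem hx.
  exact: fourier_bessel_integrand_re.
exact: fourier_bessel_integrand_im.
Qed.

End ComplexTransform.

Theorem corollary7p5 (R : realType) (nu : R) (hnu : -1 < nu) :
  (forall f : R -> R[i], schwartz_half f ->
     (forall y : R, 0 < y ->
        Cintegrable `]0, +oo[ (fourier_bessel_integrand nu f y)) /\
     schwartz_half (fourier_bessel nu f)) /\
  (forall f : R -> R[i], schwartz_half f ->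
     forall x : R, 0 < x ->
       fourier_bessel nu (fourier_bessel nu f) x = f x).
Proof.
split=> f /schwartz_halfP[u [v [Eu Ev fuv]]].
  split=> [y|]; first exact: fourier_bessel_Cintegrable Eu Ev fuv _.
  apply/schwartz_halfP; exists (FB nu u), (FB nu v).
  by split; [exact: FB_schwartz|exact: FB_schwartz|exact: fourier_besselE].
(* The inner use describes the first transform on the half-line by its real and imaginary parts,
   which is the decomposition that the second transform requires of its argument. *)
move=> x x0; rewrite (fourier_besselE hnu (fourier_besselE hnu fuv))//.
by rewrite !FB_involutive// fuv.
Qed.
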